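(* Let $R$ be a commutative ring and $S$ a multiplicative subset of $R$. Let $S\mathcal{F}$ be the class of all $S$-flat $R$-modules and $S\mathcal{C}$ the class of all $S$-cotorsion $R$-modules. Then $(S\mathcal{F}, S\mathcal{C})$ is a hereditary perfect cotorsion pair.
   Context: All rings are commutative with identity, all modules are unitary. A multiplicative subset $S\subseteq R$ satisfies $1\in S$, $s_1s_2\in S$ for all $s_1,s_2\in S$, and $0\notin S$. $M_S\cong R_S\otimes_R M$ denotes localization at $S$. An $R$-module $M$ is $S$-flat if for every finitely generated ideal $I$ of $R$ the induced map $(I\otimes_R M)_S\to (R\otimes_R M)_S$ is a monomorphism; equivalently, $M_S$ is a flat $R_S$-module. An $R$-module $C$ is $S$-cotorsion if $\operatorname{Ext}^1_R(F,C)=0$ for every $S$-flat $R$-module $F$. For a class $\mathcal{X}$ of $R$-modules, $\mathcal{X}^{\perp}=\{X : \operatorname{Ext}^1_R(Y,X)=0 \text{ for all } Y\in\mathcal{X}\}$ and ${}^{\perp}\mathcal{X}=\{X : \operatorname{Ext}^1_R(X,Y)=0\text{ for all }Y\in\mathcal{X}\}$. A homomorphism $\phi:M\to X$ with $X\in\mathcal{X}$ is an $\mathcal{X}$-preenvelope of $M$ if $\operatorname{Hom}_R(\phi,X'):\operatorname{Hom}_R(X,X')\to\operatorname{Hom}_R(M,X')$ is surjective for every $X'\in\mathcal{X}$; it is an $\mathcal{X}$-envelope if moreover every endomorphism $g:X\to X$ with $g\phi=\phi$ is an isomorphism. $\mathcal{X}$-precovers and $\mathcal{X}$-covers $\phi:X\to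 M$ are defined dually. A pair $(\mathcal{X},\mathcal{Y})$ of classes of $R$-modules is a cotorsion pair if $\mathcal{X}^{\perp}=\mathcal{Y}$ and ${}^{\perp}\mathcal{Y}=\mathcal{X}$. It is perfect if every $R$-module has an $\mathcal{X}$-cover and a $\mathcal{Y}$-envelope. It is hereditary if whenever $0\to X'\to X\to X''\to 0$ is exact with $X,X''\in\mathcal{X}$, then $X'\in\mathcal{X}$. *)

(* Defs.v *)
From HB Require Import structures.
From mathcomp Require Import all_boot all_algebra.
From mathcomp Require Import boolp classical_sets functions.
From mathcomp Require Import freeg ring.

Set Implicit Arguments.
Unset Strict Implicit.
Unset Printing Implicit Defensive.

Import GRing.Theory.
Local Open Scope ring_scope.
Local Open Scope quotient_scope.

(** * Submodules, quotient modules, kernels, free modules *)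

(* Subsets and relations are boolean-valued, as everywhere in mathcomp; an
   arbitrary predicate P is turned into a boolean one by `[< P >] (boolp). *)

Section Submodule.
Variables (R : pzRingType) (V : lmodType R) (W : submodClosed V).

Record submodule := Submodule { submodule_val :> V; _ : submodule_val \in W }.

HB.instance Definition _ := [isSub for submodule_val].
HB.instance Definition _ := [Choice of submodule by <:].
HB.instance Definition _ := [SubChoice_isSubLmodule of submodule by <:].

Definition submodule_incl : {linear submodule -> V} := val.

End Submodule.

Section QuotientModule.
Variables (R : pzRingType) (V : lmodType R) (W : submodClosed V).

(* [submodClosed V] is not declared closed under opposites in mathcomp, which
   Quotient.quot requires. *)
Definition zmod_pred : {pred V} := fun x => x \in W.

Lemma zmod_pred_closed : zmod_closed zmod_pred.
Proof.
split=> [|x y Wx Wy]; first exact: rpred0.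
by rewrite /zmod_pred unfold_in /zmod_pred -scaleN1r rpredD ?rpredZ.
Qed.
HB.instance Definition _ := GRing.isZmodClosed.Build V zmod_pred zmod_pred_closed.

Definition quotmod := Quotient.quot zmod_pred.
HB.instance Definition _ := GRing.Zmodule.on quotmod.

Definition quotmod_proj (x : V) : quotmod := \pi x.

Lemma quotmod_eqP (x y : V) :
  reflect (quotmod_proj x = quotmod_proj y) (x - y \in W).
Proof.
apply: (iffP idP) => [xyW|/eqP].
  by apply/eqP; rewrite /quotmod_proj -Quotient.idealrBE.
by rewrite /quotmod_proj -Quotient.idealrBE.
Qed.

Lemma quotmod_projK (x : quotmod) : quotmod_proj (repr x) = x.
Proof. exact: reprK. Qed.

Lemma quotmod_projD x y : quotmod_proj (x + y) = quotmod_proj x + quotmod_proj y.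
Proof. exact: Quotient.pi_add. Qed.

Definition quotmod_scale (a : R) (x : quotmod) : quotmod :=
  quotmod_proj (a *: repr x).

Lemma quotmod_scale_proj a x : quotmod_scale a (quotmod_proj x) = quotmod_proj (a *: x).
Proof.
by apply/quotmod_eqP; rewrite -scalerBr rpredZ //; apply/quotmod_eqP/quotmod_projK.
Qed.

Lemma quotmod_scaleA a b x :
  quotmod_scale a (quotmod_scale b x) = quotmod_scale (a * b) x.
Proof. by rewrite -[x]quotmod_projK !quotmod_scale_proj scalerA. Qed.

Lemma quotmod_scale1 : left_id 1 quotmod_scale.
Proof. by move=> x; rewrite -[x]quotmod_projK quotmod_scale_proj scale1r. Qed.

Lemma quotmod_scaleDr : right_distributive quotmod_scale +%R.
Proof.
move=> a x y; rewrite -[x]quotmod_projK -[y]quotmod_projK.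
by rewrite -quotmod_projD !quotmod_scale_proj scalerDr quotmod_projD.
Qed.

Lemma quotmod_scaleDl x : {morph quotmod_scale^~ x : a b / a + b}.
Proof.
move=> a b; rewrite -[x]quotmod_projK.
by rewrite !quotmod_scale_proj scalerDl quotmod_projD.
Qed.

HB.instance Definition _ := GRing.Zmodule_isLmodule.Build R quotmod
  quotmod_scaleA quotmod_scale1 quotmod_scaleDr quotmod_scaleDl.

Lemma quotmod_proj_linear : linear quotmod_proj.
Proof. by move=> a x y; rewrite quotmod_projD -quotmod_scale_proj. Qed.
HB.instance Definition _ :=
  GRing.isLinear.Build R V quotmod _ quotmod_proj quotmod_proj_linear.

End QuotientModule.

Section Span.
Variables (R : pzRingType) (V : lmodType R) (G : V -> Prop).

Definition span_pred : {pred V} := fun x =>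
  `[< exists s : seq (R * V),
        (forall p, p \in s -> G p.2) /\ x = \sum_(p <- s) p.1 *: p.2 >].

Lemma span_pred_closed : submod_closed span_pred.
Proof.
split; first by apply/asboolP; exists [::]; rewrite big_nil.
move=> a x y /asboolP[s [Gs ->]] /asboolP[t [Gt ->]]; apply/asboolP.
exists ([seq (a * p.1, p.2) | p <- s] ++ t); split=> [p|].
  by rewrite mem_cat => /orP[/mapP[q qs ->]|/Gt//]; exact: (Gs q).
rewrite big_cat big_map scaler_sumr; congr (_ + _).
by apply: eq_bigr => p _; rewrite scalerA.
Qed.
HB.instance Definition _ := GRing.isSubmodClosed.Build R V span_pred
  (GRing.submod_closed_semi span_pred_closed).

Lemma mem_span x : G x -> x \in span_pred.
Proof.
move=> Gx; apply/asboolP; exists [:: (1, x)].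
by rewrite big_seq1 scale1r; split=> // p; rewrite mem_seq1 => /eqP->.
Qed.

End Span.

Section Kernel.
Variables (R : pzRingType) (V W : lmodType R) (f : {linear V -> W}).

Definition ker_pred : {pred V} := fun x => f x == 0.

Lemma ker_pred_closed : submod_closed ker_pred.
Proof.
by split=> [|a x y]; rewrite !unfold_in ?raddf0 // linearP => /eqP-> /eqP->;
  rewrite scaler0 addr0.
Qed.
HB.instance Definition _ := GRing.isSubmodClosed.Build R V ker_pred
  (GRing.submod_closed_semi ker_pred_closed).

Definition ker : lmodType R := submodule ker_pred.
Definition ker_incl : {linear ker -> V} := submodule_incl ker_pred.

End Kernel.

Section Free.
Variables (R : comNzRingType) (X : choiceType).

Definition free : lmodType R := {freeg X / R}.

Definition free_gen (x : X) : free := Freeg [:: (1, x)].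

Variables (V : lmodType R) (f : X -> V).

Definition free_lift (u : free) : V := fglift f u.

Lemma free_lift_gen x : free_lift (free_gen x) = f x.
Proof. by rewrite /free_lift /free_gen liftU scale1r. Qed.

Lemma free_lift_linear : linear free_lift.
Proof.
have liftB (u v : free) : free_lift (u - v) = free_lift u - free_lift v.
  exact: lift_is_additive.
pose F : {additive free -> V} := HB.pack free_lift
  (GRing.isZmodMorphism.Build free V free_lift liftB).
have liftZ a (u : free) : F (a *: u) = a *: F u.
  rewrite -[u in RHS]freeg_sumE -[a *: u]/(fgscale a u) /fgscale.
  rewrite (raddf_sum F) (raddf_sum F) scaler_sumr.
  by apply: eq_bigr => x _; rewrite /F /= /free_lift !liftU scalerA.
by move=> a u v; rewrite -[free_lift _]/(F _) raddfD liftZ.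
Qed.
HB.instance Definition _ :=
  GRing.isLinear.Build R free V _ free_lift free_lift_linear.

End Free.

(** * Tensor product *)

Section Tensor.
Variables (R : comNzRingType) (M N : lmodType R).

Let gen (m : M) (n : N) : free R (M * N)%type := free_gen R (m, n).

Inductive tensor_rel : free R (M * N)%type -> Prop :=
| TensorDl m m' n : tensor_rel (gen (m + m') n - (gen m n + gen m' n))
| TensorDr m n n' : tensor_rel (gen m (n + n') - (gen m n + gen m n'))
| TensorZl a m n : tensor_rel (gen (a *: m) n - a *: gen m n)
| TensorZr a m n : tensor_rel (gen m (a *: n) - a *: gen m n).

Definition tensor : lmodType R := quotmod (span_pred tensor_rel).

Definition tens (m : M) (n : N) : tensor := quotmod_proj _ (gen m n).

Lemma tensDl m m' n : tens (m + m') n = tens m n + tens m' n.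
Proof. by rewrite /tens -raddfD; apply/quotmod_eqP/mem_span/TensorDl. Qed.

Lemma tensDr m n n' : tens m (n + n') = tens m n + tens m n'.
Proof. by rewrite /tens -raddfD; apply/quotmod_eqP/mem_span/TensorDr. Qed.

Lemma tensZl a m n : tens (a *: m) n = a *: tens m n.
Proof. by rewrite /tens -linearZ; apply/quotmod_eqP/mem_span/TensorZl. Qed.

Lemma tensZr a m n : tens m (a *: n) = a *: tens m n.
Proof. by rewrite /tens -linearZ; apply/quotmod_eqP/mem_span/TensorZr. Qed.

End Tensor.

Section TensorMap.
Variables (R : comNzRingType) (M M' N N' : lmodType R).
Variables (f : {linear M -> M'}) (g : {linear N -> N'}).

Let h : {linear free R (M * N)%type -> tensor M' N'} :=
  free_lift (fun p => tens (f p.1) (g p.2)).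

Definition tensor_map (t : tensor M N) : tensor M' N' := h (repr t).

Lemma tensor_map_proj u : tensor_map (quotmod_proj _ u) = h u.
Proof.
suff hW v : v \in span_pred (@tensor_rel R M N) -> h v = 0.
  apply/eqP; rewrite /tensor_map -subr_eq0 -(raddfB h).
  exact/eqP/hW/quotmod_eqP/quotmod_projK.
move=> /asboolP[s [sW ->]]; rewrite linear_sum big_seq big1 // => p /sW pW.
rewrite (linearZZ h); suff -> : h p.2 = 0 by rewrite scaler0.
have hgen m n : h (free_gen R (m, n)) = tens (f m) (g n) by exact: free_lift_gen.
case: pW => *; rewrite (linearB h) ?(linearD h) ?(linearZZ h) !hgen.
- by rewrite (linearD f) tensDl subrr.
- by rewrite (linearD g) tensDr subrr.
- by rewrite (linearZZ f) tensZl subrr.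
- by rewrite (linearZZ g) tensZr subrr.
Qed.

Lemma tensor_map_tens m n : tensor_map (tens m n) = tens (f m) (g n).
Proof. by rewrite tensor_map_proj [LHS]free_lift_gen. Qed.

Lemma tensor_map_linear : linear tensor_map.
Proof.
move=> a x y; rewrite -[x]quotmod_projK -[y]quotmod_projK -linearP.
by rewrite !tensor_map_proj linearP.
Qed.
HB.instance Definition _ :=
  GRing.isLinear.Build R _ _ _ tensor_map tensor_map_linear.

End TensorMap.

(** * Localization at a multiplicative subset *)

Section Localization.
Variables (R : comNzRingType) (S : mulrClosed R) (V : lmodType R).

Let frac := (V * {s : R | s \in S})%type.

(* (x, s) stands for x / s. *)
Definition loc_rel (p q : frac) : bool :=
  `[< exists2 u, u \in S & u *: (val q.2 *: p.1) = u *: (val p.2 *: q.1) >].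

Lemma loc_rel_equiv : equiv_class_of loc_rel.
Proof.
split=> [p|p q|q p r].
- by apply/asboolP; exists 1; rewrite ?rpred1.
- by apply/asboolP/asboolP => -[u uS E]; exists u.
move=> /asboolP[u uS pq] /asboolP[v vS qr]; apply/asboolP.
exists (u * v * val q.2); first by rewrite !rpredM ?(valP q.2).
have -> : (u * v * val q.2) *: (val r.2 *: p.1) =
    (v * val r.2) *: (u *: (val q.2 *: p.1)).
  by rewrite !scalerA /=; congr (_ *: _); ring.
have -> : (u * v * val q.2) *: (val p.2 *: r.1) =
    (u * val p.2) *: (v *: (val q.2 *: r.1)).
  by rewrite !scalerA /=; congr (_ *: _); ring.
by rewrite pq -qr !scalerA /=; congr (_ *: _); ring.
Qed.

Canonical loc_equiv := EquivRelPack loc_rel_equiv.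

Definition loc := {eq_quot loc_rel}.
HB.instance Definition _ := Choice.on loc.
HB.instance Definition _ := EqQuotient.on loc.

Definition loc_frac (x : V) (s : {s : R | s \in S}) : loc := \pi_loc (x, s).

Lemma loc_fracP x s y t :
  reflect (exists2 u, u \in S & u *: (val t *: x) = u *: (val s *: y))
          (loc_frac x s == loc_frac y t).
Proof. by rewrite /loc_frac eqmodE; apply: asboolP. Qed.

Lemma loc_fracE (p : loc) : exists x s, p = loc_frac x s.
Proof.
exists (repr p).1, (repr p).2.
by rewrite /loc_frac -surjective_pairing reprK.
Qed.

Definition loc_one : {s : R | s \in S} := exist _ 1 (@rpred1 _ S).

Definition loc_mul (s t : {s : R | s \in S}) : {s : R | s \in S} :=
  exist _ (val s * val t) (@rpredM _ S _ _ (valP s) (valP t)).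

Definition loc_zero : loc := loc_frac 0 loc_one.

Definition loc_opp (p : loc) : loc := loc_frac (- (repr p).1) (repr p).2.

Definition loc_add (p q : loc) : loc :=
  loc_frac (val (repr q).2 *: (repr p).1 + val (repr p).2 *: (repr q).1)
           (loc_mul (repr p).2 (repr q).2).

Lemma loc_frac_repr x s : exists2 u, u \in S &
  u *: (val s *: (repr (loc_frac x s)).1) = u *: (val (repr (loc_frac x s)).2 *: x).
Proof.
by apply/loc_fracP; rewrite /loc_frac -surjective_pairing reprK.
Qed.

Lemma loc_opp_frac x s : loc_opp (loc_frac x s) = loc_frac (- x) s.
Proof.
have [u uS E] := loc_frac_repr x s; apply/eqP/loc_fracP; exists u => //.
by rewrite !scalerN E.
Qed.

Lemma loc_add_frac x s y t :
  loc_add (loc_frac x s) (loc_frac y t) =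
  loc_frac (val t *: x + val s *: y) (loc_mul s t).
Proof.
have [u uS E] := loc_frac_repr x s; have [v vS F] := loc_frac_repr y t.
apply/eqP; rewrite /loc_add; move: E F; move: (repr _) (repr _) => [y' t'] [x' s'] /= E F.
apply/loc_fracP; exists (u * v); rewrite ?rpredM //= !scalerDr; congr (_ + _).
  transitivity ((v * val t * val t') *: (u *: (val s *: x'))).
    by rewrite !scalerA /=; congr (_ *: _); ring.
  by rewrite E !scalerA /=; congr (_ *: _); ring.
transitivity ((u * val s * val s') *: (v *: (val t *: y'))).
  by rewrite !scalerA /=; congr (_ *: _); ring.
by rewrite F !scalerA /=; congr (_ *: _); ring.
Qed.

Lemma loc_addA : associative loc_add.
Proof.
move=> p q r; have [x [s ->]] := loc_fracE p; have [y [t ->]] := loc_fracE q.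
have [z [w ->]] := loc_fracE r; rewrite !loc_add_frac; apply/eqP/loc_fracP.
exists 1; first exact: rpred1.
by rewrite /= !scalerDr !scalerA -addrA; congr (_ *: _ + (_ *: _ + _ *: _)); ring.
Qed.

Lemma loc_addC : commutative loc_add.
Proof.
move=> p q; have [x [s ->]] := loc_fracE p; have [y [t ->]] := loc_fracE q.
rewrite !loc_add_frac; apply/eqP/loc_fracP; exists 1; first exact: rpred1.
by rewrite /= addrC (mulrC (sval t)).
Qed.

Lemma loc_add0 : left_id loc_zero loc_add.
Proof.
move=> p; have [x [s ->]] := loc_fracE p.
rewrite loc_add_frac; apply/eqP/loc_fracP; exists 1; first exact: rpred1.
by rewrite /= scaler0 add0r !scale1r mul1r.
Qed.

Lemma loc_addN : left_inverse loc_zero loc_opp loc_add.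
Proof.
move=> p; have [x [s ->]] := loc_fracE p.
rewrite loc_opp_frac loc_add_frac; apply/eqP/loc_fracP.
by exists 1; [exact: rpred1 | rewrite /= scalerN addNr !scaler0].
Qed.

HB.instance Definition _ :=
  GRing.isZmodule.Build loc loc_addA loc_addC loc_add0 loc_addN.

Lemma loc_fracD x s y t :
  loc_frac x s + loc_frac y t = loc_frac (val t *: x + val s *: y) (loc_mul s t).
Proof. exact: loc_add_frac. Qed.

End Localization.

Section LocalizedRing.
Variables (R : comNzRingType) (S : mulrClosed R).

Definition loc_ring := @loc R S R^o.
HB.instance Definition _ := GRing.Zmodule.on loc_ring.

(* (a / s) . (x / t) = (a x) / (s t) *)
Definition loc_scale (V : lmodType R) (a : loc_ring) (p : loc S V) : loc S V :=
  @loc_frac R S V (((repr a).1 : R) *: (repr p).1)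
                  (@loc_mul R S (repr a).2 (repr p).2).

Lemma loc_scale_frac (V : lmodType R) (a : R) s (x : V) t :
  loc_scale (@loc_frac R S R^o a s) (loc_frac x t) =
  loc_frac (a *: x) (loc_mul s t).
Proof.
have [u uS E] := @loc_frac_repr R S R^o a s; have [v vS F] := loc_frac_repr x t.
apply/eqP; rewrite /loc_scale; move: E F; move: (repr _) (repr _) => [x' t'] [a' s'] /= E F.
apply/loc_fracP; exists (u * v); rewrite ?rpredM //=.
transitivity ((u *: (val s *: a')) *: (v *: (val t *: x'))).
  by rewrite !scalerA; congr (_ *: _); rewrite /GRing.scale /=; ring.
by rewrite E F !scalerA; congr (_ *: _); rewrite /GRing.scale /=; ring.
Qed.

Definition loc_ring_one : loc_ring := @loc_frac R S R^o 1 (loc_one S).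
Definition loc_ring_mul (a b : loc_ring) : loc_ring := loc_scale a b.

Section Scale.
Variable V : lmodType R.

Lemma loc_scaleA (a b : loc_ring) (p : loc S V) :
  loc_scale a (loc_scale b p) = loc_scale (loc_ring_mul a b) p.
Proof.
have [x [s ->]] := loc_fracE a; have [y [t ->]] := loc_fracE b.
have [z [w ->]] := loc_fracE p; rewrite /loc_ring_mul !loc_scale_frac.
apply/eqP/loc_fracP; exists 1; first exact: rpred1.
by rewrite /= !scalerA; congr (_ *: _); rewrite /GRing.scale /=; ring.
Qed.

Lemma loc_scale1 : left_id loc_ring_one (@loc_scale V).
Proof.
move=> p; have [x [s ->]] := loc_fracE p; rewrite loc_scale_frac.
apply/eqP/loc_fracP; exists 1; first exact: rpred1.
by rewrite /= !scale1r mul1r.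
Qed.

Lemma loc_scaleDr : right_distributive (@loc_scale V) +%R.
Proof.
move=> a p q; have [x [s ->]] := loc_fracE a; have [y [t ->]] := loc_fracE p.
have [z [w ->]] := loc_fracE q; rewrite ![_ + _]loc_add_frac !loc_scale_frac.
rewrite [RHS]loc_add_frac; apply/eqP/loc_fracP; exists 1; first exact: rpred1.
by rewrite /= !scalerDr !scalerA; congr (_ *: _ + _ *: _); ring.
Qed.

Lemma loc_scaleDl p : {morph (@loc_scale V)^~ p : a b / a + b}.
Proof.
move=> a b; have [x [s ->]] := loc_fracE a; have [y [t ->]] := loc_fracE b.
have [z [w ->]] := loc_fracE p; rewrite [_ + _]loc_add_frac !loc_scale_frac.
rewrite [RHS]loc_add_frac; apply/eqP/loc_fracP; exists 1; first exact: rpred1.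
rewrite /= scalerDl !scalerDr !scalerA.
by congr (_ *: _ + _ *: _); rewrite /GRing.scale /=; ring.
Qed.

End Scale.

Lemma loc_ring_mulC : commutative loc_ring_mul.
Proof.
move=> a b; have [x [s ->]] := loc_fracE a; have [y [t ->]] := loc_fracE b.
rewrite /loc_ring_mul !loc_scale_frac; apply/eqP/loc_fracP.
by exists 1; [exact: rpred1 | rewrite /GRing.scale /=; ring].
Qed.

Lemma loc_ring_mulA : associative loc_ring_mul.
Proof. exact: loc_scaleA. Qed.

Lemma loc_ring_mul1 : left_id loc_ring_one loc_ring_mul.
Proof. exact: loc_scale1. Qed.

Lemma loc_ring_mulDl : left_distributive loc_ring_mul +%R.
Proof. by move=> a b c; apply: loc_scaleDl. Qed.

HB.instance Definition _ := GRing.Zmodule_isComPzRing.Build loc_ring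
  loc_ring_mulA loc_ring_mulC loc_ring_mul1 loc_ring_mulDl.

HB.instance Definition _ (V : lmodType R) :=
  GRing.Zmodule_isLmodule.Build loc_ring (loc S V)
    (@loc_scaleA V) (@loc_scale1 V) (@loc_scaleDr V) (@loc_scaleDl V).

Lemma loc_fracZ (V : lmodType R) (a : R) s (x : V) t :
  (@loc_frac R S R^o a s : loc_ring) *: loc_frac x t =
  loc_frac (a *: x) (loc_mul s t).
Proof. exact: loc_scale_frac. Qed.

Variables (V W : lmodType R) (f : {linear V -> W}).

(* f_S (x / s) = f x / s *)
Definition loc_map (p : loc S V) : loc S W := loc_frac (f (repr p).1) (repr p).2.

Lemma loc_map_frac x s : loc_map (loc_frac x s) = loc_frac (f x) s.
Proof.
have [u uS E] := loc_frac_repr x s; apply/eqP/loc_fracP; exists u => //.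
by rewrite -!(linearZZ f) E.
Qed.

Lemma loc_map_linear : linear loc_map.
Proof.
move=> a p q; have [x [s ->]] := loc_fracE a; have [y [t ->]] := loc_fracE p.
have [z [w ->]] := loc_fracE q.
by rewrite loc_fracZ loc_fracD !loc_map_frac loc_fracZ loc_fracD
  (linearD f) !(linearZZ f).
Qed.
HB.instance Definition _ :=
  GRing.isLinear.Build loc_ring (loc S V) (loc S W) _ loc_map loc_map_linear.

End LocalizedRing.

Arguments loc_map {R} S {V W} f p.

(** * Ext^1 *)

Section Ext1.
Variables (R : comNzRingType) (F C : lmodType R).

(* A free resolution res2 -> res1 -> res0 -> F -> 0, each free module being
   generated by the elements of the kernel to be covered. *)
Definition res0 : lmodType R := free R F.
Definition aug : {linear res0 -> F} := free_lift (fun x : F => x).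

Definition res1 : lmodType R := free R (ker aug).
Definition diff1 : {linear res1 -> res0} :=
  ker_incl aug \o free_lift (fun x : ker aug => x).

Definition res2 : lmodType R := free R (ker diff1).
Definition diff2 : {linear res2 -> res1} :=
  ker_incl diff1 \o free_lift (fun x : ker diff1 => x).

(* Ext^1_R(F, C) is the cohomology of
   Hom(res0, C) -> Hom(res1, C) -> Hom(res2, C) in the middle. *)
Definition cocycle_pred : {pred (res1 -> C)} := fun f =>
  `[< linear f /\ forall z, f (diff2 z) = 0 >].

Lemma cocycle_pred_closed : submod_closed cocycle_pred.
Proof.
split=> [|a f g /asboolP[lf f0] /asboolP[lg g0]]; apply/asboolP; split.
- by move=> a x y; rewrite /= scaler0 addr0.
- by [].
- move=> b x y; rewrite [LHS]/(a *: f _ + g _) lf lg.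
  rewrite [RHS]/(b *: (a *: f x + g x) + (a *: f y + g y)).
  by rewrite !scalerDr !scalerA (mulrC a); exact: addrACA.
- by move=> z; rewrite [LHS]/(a *: f _ + g _) f0 g0 scaler0; apply: addr0.
Qed.
HB.instance Definition _ := GRing.isSubmodClosed.Build R (res1 -> C) cocycle_pred
  (GRing.submod_closed_semi cocycle_pred_closed).

Definition cocycles : lmodType R := submodule cocycle_pred.

Definition coboundary_pred : {pred cocycles} := fun f =>
  `[< exists g : {linear res0 -> C}, val f = g \o diff1 >].

Lemma coboundary_pred_closed : submod_closed coboundary_pred.
Proof.
split=> [|a f1 f2 /asboolP[g1 E1] /asboolP[g2 E2]]; apply/asboolP.
  by exists \0.
exists (a \*: g1 \+ g2).
by rewrite linearP /= E1 E2.
Qed.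
HB.instance Definition _ := GRing.isSubmodClosed.Build R cocycles coboundary_pred
  (GRing.submod_closed_semi coboundary_pred_closed).

Definition Ext1 : lmodType R := quotmod coboundary_pred.

Definition Ext1_trivial : Prop := forall x : Ext1, x = 0.

End Ext1.

(** * Classes of modules, cotorsion pairs *)

Section ModuleClasses.
Variable R : comNzRingType.

Definition module_class := lmodType R -> Prop.

Implicit Types (X Y : module_class) (M N : lmodType R).

Definition rperp X : module_class := fun N => forall M, X M -> Ext1_trivial M N.
Definition lperp Y : module_class := fun M => forall N, Y N -> Ext1_trivial M N.

Definition is_preenvelope X M N (phi : {linear M -> N}) : Prop :=
  X N /\ forall N', X N' -> forall f : {linear M -> N'},
    exists g : {linear N -> N'}, g \o phi =1 f.

Definition is_envelope X M N (phi : {linear M -> N}) : Prop :=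
  is_preenvelope X phi /\
  forall g : {linear N -> N}, g \o phi =1 phi -> bijective g.

Definition is_precover X M N (phi : {linear N -> M}) : Prop :=
  X N /\ forall N', X N' -> forall f : {linear N' -> M},
    exists g : {linear N' -> N}, phi \o g =1 f.

Definition is_cover X M N (phi : {linear N -> M}) : Prop :=
  is_precover X phi /\
  forall g : {linear N -> N}, phi \o g =1 phi -> bijective g.

Definition short_exact M' M M'' (i : {linear M' -> M}) (p : {linear M -> M''}) :=
  [/\ injective i, forall x, p x = 0 <-> exists y, i y = x
    & forall z, exists x, p x = z].

Definition cotorsion_pair X Y : Prop :=
  (forall N, rperp X N <-> Y N) /\ (forall M, lperp Y M <-> X M).

Definition perfect X Y : Prop :=
  (forall M, exists N (phi : {linear N -> M}), is_cover X phi) /\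
  (forall M, exists N (phi : {linear M -> N}), is_envelope Y phi).

Definition hereditary X : Prop :=
  forall M' M M'' (i : {linear M' -> M}) (p : {linear M -> M''}),
    short_exact i p -> X M -> X M'' -> X M'.

End ModuleClasses.

(** * S-flat and S-cotorsion modules *)

Section SFlat.
Variables (R : comNzRingType) (S : mulrClosed R).

(* Ideals of R are the submodules of the regular module R^o. *)
Definition fg_ideal (I : submodClosed R^o) : Prop :=
  exists (n : nat) (g : 'I_n -> R), forall x : R,
    x \in I <-> exists c : 'I_n -> R, x = \sum_(i < n) c i * g i.

Definition S_flat : module_class R := fun M =>
  forall I : submodClosed R^o, fg_ideal I ->
    injective (loc_map S (tensor_map (submodule_incl I) (idfun : {linear M -> M}))).

Definition S_cotorsion : module_class R := fun C =>
  forall F, S_flat F -> Ext1_trivial F C.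

End SFlat.

(* Main.v *)
Require Import Defs.
From HB Require Import structures.
From mathcomp Require Import all_boot all_algebra.
From mathcomp Require Import boolp classical_sets functions.
From mathcomp Require freeg.
(* Imported again because all_algebra shadows the free modules [free]. *)
Require Import Defs.

(* Both "every S-flat module over M" and "every S-flat extension of M" are
   categories of factorizations A -> X -> B of a fixed map, whose first factor is
   injective with S-flat cokernel (A = 0, resp. B = 0).  By the equational
   criterion S-flatness is a condition on finitely many elements, so it passes to
   unions of chains.  Objects are presented as quotients V/K with V the span of A
   and of a set L of labelled blocks of generators in one big module, so that
   direct systems become chains of pairs (L, K) and Zorn's lemma replaces
   transfinite induction; labels are inductively generated trees, rich enough
   that every relevant datum of V/K has its own label.
   A first maximal pair yields X -> B with the right lifting property against
   injections with S-flat cokernel: it suffices to solve the lifting problems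
   inside one free module depending only on R, since every element of an S-flat
   quotient lies in an S-pure submodule generated by that module.  A second one
   yields a weakly terminal object all of whose endomorphisms are injective, and
   Cantor's theorem forces them to be surjective.  These minimal objects are the
   covers and envelopes; kernels of covers being S-cotorsion, a module in the left
   orthogonal of the S-cotorsion modules is a direct summand of an S-flat one. *)

Set Implicit Arguments.
Unset Strict Implicit.
Unset Printing Implicit Defensive.

Import GRing.Theory.
Local Open Scope ring_scope.

(** * Flatness in an ambient module *)

Section Subspaces.
Variables (R : comNzRingType) (V : lmodType R).

Definition subspace (K : V -> Prop) : Prop :=
  K 0 /\ forall a x y, K x -> K y -> K (a *: x + y).

Variables (K : V -> Prop) (subK : subspace K).

Lemma subspace0 : K 0. Proof. exact: subK.1. Qed.

Lemma subspaceZ a x : K x -> K (a *: x).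
Proof. by move=> Kx; rewrite -[_ *: _]addr0; apply: subK.2 => //; exact: subK.1. Qed.

Lemma subspaceD x y : K x -> K y -> K (x + y).
Proof. by move=> Kx Ky; rewrite -[x]scale1r; exact: subK.2. Qed.

Lemma subspaceN x : K x -> K (- x).
Proof. by rewrite -scaleN1r; exact: subspaceZ. Qed.

Lemma subspaceB x y : K x -> K y -> K (x - y).
Proof. by move=> Kx /subspaceN; exact: subspaceD. Qed.

Lemma subspace_sum I (r : seq I) (P : pred I) (F : I -> V) :
  (forall i, P i -> K (F i)) -> K (\sum_(i <- r | P i) F i).
Proof. by move=> KF; apply: big_ind => //; [exact: subspace0 | exact: subspaceD]. Qed.

Lemma subspace_cong x y : K (x - y) -> K x <-> K y.
Proof.
move=> Kxy; split=> [Kx|Ky]; last by rewrite -(subrK y x); exact: subspaceD.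
by rewrite -(subKr x y); exact: subspaceB.
Qed.

End Subspaces.

Section LinearMaps.
Variable R : comNzRingType.
Implicit Types U V W : lmodType R.

Lemma ex_linear U V (f : U -> V) : linear f -> exists g : {linear U -> V}, g =1 f.
Proof.
move=> lf.
pose g : {linear U -> V} := HB.pack f (GRing.isLinear.Build R U V _ f lf).
by exists g.
Qed.

(** Maps are obtained below from their graphs: single-valuedness turns closure under linear
    combinations into linearity of any choice function. *)
Lemma ex_linear_rel U V (P : U -> V -> Prop) :
    (forall x, exists y, P x y) ->
    (forall x y y', P x y -> P x y' -> y = y') ->
    (forall a x y x' y', P x y -> P x' y' -> P (a *: x + x') (a *: y + y')) ->
  exists g : {linear U -> V}, forall x, P x (g x).
Proof.
move=> /choice[f Pf] Pfun Plin.
have [|g gE] := @ex_linear U V f; last by exists g => x; rewrite gE.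
by move=> a x y; apply: Pfun (Pf _) _; apply: Plin.
Qed.

Lemma ex_quotient V (K : V -> Prop) : subspace K ->
  exists (Q : lmodType R) (q : {linear V -> Q}),
    (forall x, q x = 0 <-> K x) /\ (forall z, exists x, q x = z).
Proof.
move=> subK; exists (quotmod (span_pred K)), (quotmod_proj (span_pred K)).
split=> [x|z]; last by exists (repr z); exact: quotmod_projK.
rewrite -(raddf0 (quotmod_proj (span_pred K))); split=> [|Kx].
  move/quotmod_eqP; rewrite subr0 => /asboolP[s [sK ->]].
  rewrite big_seq; apply: subspace_sum => // p ps; apply: subspaceZ => //.
  exact: sK.
by apply/quotmod_eqP; rewrite subr0; exact: mem_span.
Qed.

Lemma quotient_factor U V W (q : {linear U -> V}) (f : {linear U -> W}) :
    (forall z, exists x, q x = z) -> (forall x, q x = 0 -> f x = 0) ->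
  exists g : {linear V -> W}, forall x, g (q x) = f x.
Proof.
move=> qsurj qf.
have qfE x x' : q x = q x' -> f x = f x'.
  by move=> E; apply/eqP; rewrite -subr_eq0 -linearB qf // linearB E subrr.
have [| | |g gP] := @ex_linear_rel V W (fun z y => exists2 x, q x = z & f x = y).
- by move=> z; have [x <-] := qsurj z; exists (f x), x.
- by move=> _ y y' [x <- <-] [x' E <-]; exact: qfE.
- by move=> a _ _ _ _ [x <- <-] [x' <- <-]; exists (a *: x + x'); rewrite linearP.
by exists g => x; have [x' /qfE] := gP (q x) => <-.
Qed.

Lemma subspace_im U V (f : {linear U -> V}) : subspace (fun y => exists x, f x = y).
Proof.
split=> [|a _ _ [x <-] [y <-]]; first by exists 0; rewrite raddf0.
by exists (a *: x + y); rewrite linearP.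
Qed.

Lemma subspace_zero V : subspace (fun x : V => x = 0).
Proof. by split=> // a x y -> ->; rewrite scaler0 addr0. Qed.

End LinearMaps.

(** * Closure properties of the equational criterion *)

Section RelativeFlatness.
Variables (R : comNzRingType) (S : mulrClosed R).
Implicit Types V W : lmodType R.

(* For subspaces D of U this is the equational criterion for flatness of the
   localization of U / D, phrased inside the ambient module V so that unions of
   chains, extensions and quotients need no quotient modules. *)
Definition rel_flat V (U D : V -> Prop) : Prop :=
  forall n (a : 'I_n -> R) (m : 'I_n -> V),
    (forall i, U (m i)) -> D (\sum_i a i *: m i) ->
  exists s k (b : 'I_n -> 'I_k -> R) (y : 'I_k -> V),
    [/\ s \in S, forall j, U (y j), forall j, \sum_i a i * b i j = 0
      & forall i, D (s *: m i - \sum_j b i j *: y j)].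

Lemma exchange_comb V n k (a : 'I_n -> R) (b : 'I_n -> 'I_k -> R) (y : 'I_k -> V) :
  \sum_i a i *: (\sum_j b i j *: y j) = \sum_j (\sum_i a i * b i j) *: y j.
Proof.
under eq_bigr => i _ do rewrite scaler_sumr.
rewrite exchange_big; apply: eq_bigr => j _; rewrite scaler_suml.
by apply: eq_bigr => i _; rewrite scalerA.
Qed.

Lemma exchange_coef n k l (a : 'I_n -> R) (b : 'I_n -> 'I_k -> R) (c : 'I_k -> 'I_l -> R) j :
  \sum_i a i * (\sum_h b i h * c h j) = \sum_h (\sum_i a i * b i h) * c h j.
Proof. exact: (@exchange_comb R^o n k a b (c^~ j)). Qed.

(** Induction on the number of equations: the first is trivialized by a matrix [b], the others
    become equations in the new elements [y], and the matrices are multiplied. *)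
Lemma rel_flat_system V (U D : V -> Prop) k : subspace U -> subspace D -> rel_flat U D ->
  forall n (a : 'I_k -> 'I_n -> R) (m : 'I_n -> V),
    (forall i, U (m i)) -> (forall l, D (\sum_i a l i *: m i)) ->
  exists s p (b : 'I_n -> 'I_p -> R) (y : 'I_p -> V),
    [/\ s \in S, forall j, U (y j), forall l j, \sum_i a l i * b i j = 0
      & forall i, D (s *: m i - \sum_j b i j *: y j)].
Proof.
move=> sU sD fl; elim: k => [|k IHk] n a m Um Dm.
  exists 1, n, (fun i j => (i == j)%:R), m; split=> //; first exact: rpred1.
    by case.
  move=> i; rewrite (bigD1 i) //= eqxx scale1r big1 ?addr0 ?scale1r.
    by rewrite subrr; exact: subspace0.
  by move=> j /negPf; rewrite eq_sym => ->; rewrite scale0r.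
have [s [p [b [y [sS Uy ab Dy]]]]] := fl _ _ _ Um (Dm ord0).
have {IHk} [|t [q [c [z [tS Uz abc Dz]]]]] :=
    IHk p (fun l j => \sum_i a (lift ord0 l) i * b i j) y Uy.
  (* Substituting [\sum_j b i j *: y j] for [s *: m i] changes the remaining equations only by
     elements of [D]. *)
  move=> l; rewrite -exchange_comb.
  have -> : \sum_i a (lift ord0 l) i *: (\sum_j b i j *: y j) =
      s *: (\sum_i a (lift ord0 l) i *: m i) -
      \sum_i a (lift ord0 l) i *: (s *: m i - \sum_j b i j *: y j).
    rewrite scaler_sumr -sumrB; apply: eq_bigr => i _.
    by rewrite scalerBr !scalerA (mulrC s) subKr.
  apply: subspaceB => //; first exact: subspaceZ.
  by apply: subspace_sum => // i _; apply: subspaceZ.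
exists (t * s), q, (fun i j => \sum_h b i h * c h j), z; split=> //.
- by rewrite rpredM.
- move=> l j; rewrite exchange_coef; case: (unliftP ord0 l) => [l'|] ->.
    exact: abc.
  by apply: big1 => h _; rewrite ab mul0r.
move=> i; rewrite -exchange_comb.
have -> : (t * s) *: m i - \sum_h b i h *: (\sum_j c h j *: z j) =
    t *: (s *: m i - \sum_j b i j *: y j) +
    \sum_h b i h *: (t *: y h - \sum_j c h j *: z j).
  rewrite scalerBr scalerA -addrA; congr (_ + _).
  rewrite scaler_sumr -sumrN -sumrN -big_split; apply: eq_bigr => h _ /=.
  by rewrite scalerBr !scalerA (mulrC t) addKr.
apply: subspaceD => //; first exact: subspaceZ.
by apply: subspace_sum => // h _; apply: subspaceZ.
Qed.

(** The elements [y] found in [U] satisfy the relations [b] modulo [U']. Flatness of [U / U'] then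
    gives corrections, annihilated by [b], that move [t *: y j] into [U']. *)
Lemma rel_flat_sub V (U U' D : V -> Prop) :
    subspace U -> subspace U' -> subspace D ->
    (forall x, D x -> U' x) -> (forall x, U' x -> U x) ->
  rel_flat U D -> rel_flat U U' -> rel_flat U' D.
Proof.
move=> sU sU' sD DU' U'U flD flU' n a m U'm Dm.
have [|s [k [b [y [sS Uy ab Dy]]]]] := flD _ _ m _ Dm; first by move=> i; exact: U'U.
have [|t [l [c [z [tS Uz bc U'z]]]]] :=
    @rel_flat_system V U U' n sU sU' flU' k b y Uy.
  move=> i; rewrite -[\sum_j _](subKr (s *: m i)).
  by apply: subspaceB; [| exact: subspaceZ | exact: DU'].
exists (t * s), k, b, (fun j => t *: y j - \sum_h c j h *: z h); split=> //.
  by rewrite rpredM.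
move=> i; have -> : \sum_j b i j *: (t *: y j - \sum_h c j h *: z h) =
    t *: \sum_j b i j *: y j.
  under eq_bigr => j _ do rewrite scalerBr.
  rewrite sumrB exchange_comb [X in _ - X]big1 ?subr0.
    by rewrite scaler_sumr; apply: eq_bigr => j _; rewrite !scalerA mulrC.
  by move=> h _; rewrite bc scale0r.
by rewrite -scalerA -scalerBr; exact: subspaceZ.
Qed.

(** The relation is first trivialized modulo [U']; the remainders lie in [U'] and satisfy the same
    relation modulo [D], so the two solutions are put side by side. *)
Lemma rel_flat_ext V (U U' D : V -> Prop) :
    subspace U -> subspace U' -> subspace D ->
    (forall x, D x -> U' x) -> (forall x, U' x -> U x) ->
  rel_flat U' D -> rel_flat U U' -> rel_flat U D.
Proof.
move=> sU sU' sD DU' U'U flD flU' n a m Um Dm.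
have [s [k [b [y [sS Uy ab U'y]]]]] := flU' _ _ _ Um (DU' _ Dm).
have [|t [l [c [z [tS U'z ac Dz]]]]] := flD n a _ U'y.
  have -> : \sum_i a i *: (s *: m i - \sum_j b i j *: y j) = s *: \sum_i a i *: m i.
    under eq_bigr => i _ do rewrite scalerBr.
    rewrite sumrB exchange_comb [X in _ - X]big1 ?subr0.
      by rewrite scaler_sumr; apply: eq_bigr => j _; rewrite !scalerA mulrC.
    by move=> h _; rewrite ab scale0r.
  exact: subspaceZ.
pose J (T : Type) (f : 'I_k -> T) (g : 'I_l -> T) (j : 'I_(k + l)) :=
  match fintype.split j with inl j => f j | inr j => g j end.
have J1 T (f : 'I_k -> T) (g : 'I_l -> T) j : J T f g (lshift l j) = f j.
  by rewrite /J -[lshift l j]/(unsplit (inl j)) unsplitK.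
have J2 T (f : 'I_k -> T) (g : 'I_l -> T) j : J T f g (rshift k j) = g j.
  by rewrite /J -[rshift k j]/(unsplit (inr j)) unsplitK.
exists (t * s), (k + l)%N, (fun i => J _ (fun j => t * b i j) (c i)), (J _ y z); split.
- by rewrite rpredM.
- by move=> j; rewrite /J; case: fintype.split => j' //; exact: U'U.
- move=> j; rewrite /J; case: fintype.split => j' //.
  under eq_bigr => i _ do rewrite mulrCA.
  by rewrite -mulr_sumr ab mulr0.
move=> i; rewrite big_split_ord /=.
under eq_bigr => j _ do rewrite !J1.
under [X in _ - (_ + X)]eq_bigr => j _ do rewrite !J2.
have <- : t *: (s *: m i - \sum_j b i j *: y j) - \sum_j c i j *: z j =
  (t * s) *: m i - (\sum_j (t * b i j) *: y j + \sum_j c i j *: z j).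
  rewrite scalerBr scalerA opprD addrA scaler_sumr.
  by congr (_ - _ - _); apply: eq_bigr => j _; rewrite scalerA.
exact: Dz.
Qed.

(** The hypotheses make [f] induce an isomorphism from [U / D] to [U' / D']. *)
Lemma rel_flat_transport V W (f : {linear V -> W}) (U D : V -> Prop) (U' D' : W -> Prop) :
    subspace U -> subspace U' -> subspace D' ->
    (forall x, U x -> U' (f x)) ->
    (forall x, U x -> D x <-> D' (f x)) ->
    (forall z, U' z -> exists2 x, U x & D' (z - f x)) ->
  rel_flat U D <-> rel_flat U' D'.
Proof.
move=> sU sU' sD' fU fD fsurj; split=> fl n a m Um Dm.
  have /choice[m' m'P] i : exists x, U x /\ D' (m i - f x).
    by have [x] := fsurj _ (Um i); exists x.
  have Um' i := (m'P i).1.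
  have USm' : U (\sum_i a i *: m' i).
    by apply: subspace_sum => // i _; exact: subspaceZ.
  have [|s [k [b [y [sS Uy ab Dy]]]]] := fl n a m' Um'.
    apply/fD => //; rewrite (linear_sum f).
    apply/(subspace_cong sD' _).1: Dm; rewrite -sumrB.
    apply: subspace_sum => // i _; rewrite (linearZZ f) -scalerBr.
    by apply: subspaceZ => //; exact: (m'P i).2.
  exists s, k, b, (fun j => f (y j)); split=> // [j|i]; first exact: fU.
  have -> : s *: m i - \sum_j b i j *: f (y j) =
      s *: (m i - f (m' i)) + f (s *: m' i - \sum_j b i j *: y j).
    rewrite scalerBr (linearB f) (linearZZ f) addrA subrK (linear_sum f); congr (_ - _).
    by apply: eq_bigr => j _; rewrite (linearZZ f).
  apply: subspaceD => //; first by apply: subspaceZ => //; exact: (m'P i).2.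
  apply/fD => //; apply: subspaceB => //; first exact: subspaceZ.
  by apply: subspace_sum => // j _; exact: subspaceZ.
have [||s [k [b [y [sS Uy ab Dy]]]]] := fl n a (f \o m).
- by move=> i; exact: fU.
- have -> : \sum_i a i *: (f \o m) i = f (\sum_i a i *: m i).
    by rewrite (linear_sum f); apply: eq_bigr => i _; rewrite (linearZZ f).
  by apply/fD => //; apply: subspace_sum => // i _; exact: subspaceZ.
have /choice[y' y'P] j : exists x, U x /\ D' (y j - f x).
  by have [x] := fsurj _ (Uy j); exists x.
exists s, k, b, y'; split=> // [j|i]; first exact: (y'P j).1.
apply/fD.
  apply: subspaceB => //; first exact: subspaceZ.
  by apply: subspace_sum => // j _; apply: subspaceZ => //; exact: (y'P j).1.
have -> : f (s *: m i - \sum_j b i j *: y' j) =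
    s *: f (m i) - \sum_j b i j *: y j + \sum_j b i j *: (y j - f (y' j)).
  under [X in _ = _ + X]eq_bigr => j _ do rewrite scalerBr.
  rewrite sumrB addrA subrK (linearB f) (linearZZ f) (linear_sum f); congr (_ - _).
  by apply: eq_bigr => j _; rewrite (linearZZ f).
apply: subspaceD => //; first exact: Dy.
by apply: subspace_sum => // j _; apply: subspaceZ => //; exact: (y'P j).2.
Qed.

End RelativeFlatness.

(** * The equational criterion for S-flatness *)

Section FreeModules.
Variables (R : comNzRingType) (X : choiceType).

Lemma free_repr (u : free R X) :
  exists s : seq (R * X), u = \sum_(p <- s) p.1 *: free_gen R p.2.
Proof.
exists [seq (freeg.coeff z u, z) | z <- freeg.dom u].
rewrite big_map -[LHS]freeg.freeg_sumE; apply: eq_bigr => z _ /=.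
rewrite -[_ *: _]/(freeg.fgscale _ _); apply/eqP/freeg.freeg_eqP => x.
by rewrite freeg.coeff_fgscale !freeg.coeffU mul1r.
Qed.

Lemma ex_free_lift (V : lmodType R) (f : X -> V) :
  exists g : {linear free R X -> V}, forall x, g (free_gen R x) = f x.
Proof. by exists (free_lift f) => x; exact: free_lift_gen. Qed.

Lemma free_ext (V : lmodType R) (f g : {linear free R X -> V}) :
  (forall x, f (free_gen R x) = g (free_gen R x)) -> f =1 g.
Proof.
move=> fg u; have [s ->] := free_repr u; rewrite !linear_sum.
by apply: eq_bigr => p _; rewrite (linearZZ f) (linearZZ g) fg.
Qed.

End FreeModules.

Section TensorUniversal.
Variables (R : comNzRingType) (M N Z : lmodType R) (h : M -> N -> Z).
Hypotheses (hDl : forall m m' n, h (m + m') n = h m n + h m' n)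
  (hDr : forall m n n', h m (n + n') = h m n + h m n')
  (hZl : forall a m n, h (a *: m) n = a *: h m n)
  (hZr : forall a m n, h m (a *: n) = a *: h m n).

Lemma ex_tensor_lift :
  exists g : {linear tensor M N -> Z}, forall m n, g (tens m n) = h m n.
Proof.
have [f fE] := ex_free_lift (fun p : M * N => h p.1 p.2).
have [||g gE] := @quotient_factor R _ _ _
    (quotmod_proj (span_pred (@tensor_rel R M N))) f.
- by move=> z; exists (repr z); exact: quotmod_projK.
- move=> x; rewrite -(raddf0 (quotmod_proj _)) => /quotmod_eqP; rewrite subr0.
  move=> /asboolP[s [sW ->]]; rewrite linear_sum big_seq big1 // => p /sW pW.
  rewrite (linearZZ f); suff -> : f p.2 = 0 by rewrite scaler0.
  by case: pW => *; rewrite (linearB f) ?(linearD f) ?(linearZZ f) !fE /=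
    ?hDl ?hDr ?hZl ?hZr subrr.
by exists g => m n; rewrite gE fE.
Qed.

End TensorUniversal.

Section TensorZero.
Variables (R : comNzRingType) (M N : lmodType R).

Lemma tens_suml I (r : seq I) (F : I -> M) (n : N) :
  tens (\sum_(i <- r) F i) n = \sum_(i <- r) tens (F i) n.
Proof.
apply: (big_morph (fun m => tens m n)) => [m m'|]; first exact: tensDl.
by rewrite -[X in tens X](scale0r 0) tensZl scale0r.
Qed.

Lemma tens_sumr I (r : seq I) (F : I -> N) (m : M) :
  tens m (\sum_(i <- r) F i) = \sum_(i <- r) tens m (F i).
Proof.
apply: (big_morph (tens m)) => [n n'|]; first exact: tensDr.
by rewrite -[X in tens _ X](scale0r 0) tensZr scale0r.
Qed.

Lemma tensor_repr (t : tensor M N) :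
  exists s : seq (M * N), t = \sum_(p <- s) tens p.1 p.2.
Proof.
have [s Es] := free_repr (repr t).
exists [seq (p.1 *: p.2.1, p.2.2) | p <- s].
rewrite big_map -[LHS]quotmod_projK Es linear_sum; apply: eq_bigr => p _ /=.
rewrite tensZl (linearZZ (quotmod_proj _)); congr (_ *: quotmod_proj _ (free_gen R _)).
by case: (p.2).
Qed.

End TensorZero.

Section SFlatCriterion.
Variables (R : comNzRingType) (S : mulrClosed R) (M : lmodType R).

Definition eqflat : Prop := rel_flat S (fun _ : M => True) (fun x => x = 0).

Lemma loc_frac_eq0 (V : lmodType R) (x : V) s :
  @loc_frac R S V x s = 0 <-> exists2 u, u \in S & u *: x = 0.
Proof.
split=> [/eqP/loc_fracP[u uS]|[u uS ux0]].
  by rewrite scaler0 scaler0 /= => E; exists u; rewrite // -[RHS]E scale1r.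
by apply/eqP/loc_fracP; exists u; rewrite //= scale1r !scaler0.
Qed.

(** A fraction vanishes exactly when some element of [S] kills its numerator, so injectivity can be
    read off numerators. *)
Lemma loc_map_inj (V W : lmodType R) (f : {linear V -> W}) :
  injective (loc_map S f) <->
  (forall x, f x = 0 -> exists2 u, u \in S & u *: x = 0).
Proof.
split=> [finj x fx0|fker p q].
  apply/(loc_frac_eq0 x (loc_one S)); apply: finj.
  by rewrite loc_map_frac fx0 raddf0; apply/loc_frac_eq0; exists 1; rewrite ?rpred1 ?scaler0.
move=> /eqP; rewrite -subr_eq0 -(linearB (loc_map S f)) => /eqP.
have [x [s E]] := loc_fracE (p - q); rewrite E /= loc_map_frac.
move=> /loc_frac_eq0[u uS]; rewrite -(linearZZ f) => /fker[v vS vux].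
apply/eqP; rewrite -subr_eq0 E; apply/eqP/loc_frac_eq0.
by exists (v * u); rewrite ?rpredM // -scalerA.
Qed.

Lemma tensor_ring_mul :
  exists g : {linear tensor R^o M -> M}, forall r m, g (tens r m) = r *: m.
Proof.
apply: (@ex_tensor_lift R R^o M M (fun r m => r *: m)) => [m m' n|m n n'|a m n|a m n].
- by rewrite scalerDl.
- by rewrite scalerDr.
- by rewrite -scalerA.
- by rewrite !scalerA mulrC.
Qed.

(* Vanishing of sum_i g_i (x) m_i in I (x) M: the bilinear map
   (sum_i c_i g_i, m) |-> (c_i m)_i is well defined modulo the trivial relations. *)
Lemma tensor_ideal_vanish (I : submodClosed R^o) n (g : 'I_n -> submodule I)
    (m : 'I_n -> M) :
    (forall x : submodule I, exists c : 'I_n -> R, x = \sum_i c i *: g i) ->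
    \sum_i tens (g i) (m i) = 0 ->
  exists k (b : 'I_n -> 'I_k -> R) (y : 'I_k -> M),
    (forall j, \sum_i b i j *: g i = 0) /\ forall i, m i = \sum_j b i j *: y j.
Proof.
move=> gen m0.
pose P (f : {ffun 'I_n -> M}) := exists k (b : 'I_n -> 'I_k -> R) (y : 'I_k -> M),
    (forall j, \sum_i b i j *: g i = 0) /\ forall i, f i = \sum_j b i j *: y j.
have sP : subspace P.
  split=> [|a f1 f2 [k1 [b1 [y1 [bg1 E1]]]] [k2 [b2 [y2 [bg2 E2]]]]].
    exists 0%N, (fun _ _ => 0), (fun _ => 0).
    by split=> [[]|i]; rewrite ?big_ord0 ?ffunE.
  pose J T (u1 : 'I_k1 -> T) (u2 : 'I_k2 -> T) (j : 'I_(k1 + k2)) :=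
    match fintype.split j with inl j => u1 j | inr j => u2 j end.
  exists (k1 + k2)%N, (fun i => J _ (fun j => a * b1 i j) (b2 i)), (J _ y1 y2).
  split=> [j|i].
    rewrite /J; case: fintype.split => j' //.
    under eq_bigr => i _ do rewrite -scalerA.
    by rewrite -scaler_sumr bg1 scaler0.
  rewrite !ffunE E1 E2 big_split_ord scaler_sumr /=; congr (_ + _).
    apply: eq_bigr => j _; rewrite /J -[lshift k2 j]/(unsplit (inl j)) unsplitK.
    by rewrite scalerA.
  apply: eq_bigr => j _; rewrite /J -[rshift k1 j]/(unsplit (inr j)) unsplitK.
  by [].
have [Z [q [qP _]]] := ex_quotient sP.
have /choice[c cE] := gen.
pose h (x : submodule I) (z : M) := q [ffun i => c x i *: z].
(* The chosen coefficients [c x] need not be linear in [x], but two choices differ by a relation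
   among the [g i], whose multiples by [z] lie in [P]. *)
have hE d (x : submodule I) z : x = \sum_i d i *: g i -> h x z = q [ffun i => d i *: z].
  move=> dE; apply/eqP; rewrite -subr_eq0 -linearB; apply/eqP/qP.
  exists 1%N, (fun i _ => c x i - d i), (fun _ => z); split=> [_|i].
    under eq_bigr => i _ do rewrite scalerBl.
    by rewrite sumrB -cE -dE subrr.
  by rewrite big_ord1 !ffunE scalerBl.
have [|||| f fE] := @ex_tensor_lift R (submodule I) M Z h.
- move=> x x' z; rewrite (hE (fun i => c x i + c x' i)).
    by rewrite -linearD; congr (q _); apply/ffunP => i; rewrite !ffunE scalerDl.
  under eq_bigr => i _ do rewrite scalerDl.
  by rewrite big_split /= -!cE.
- move=> x z z'; rewrite -linearD; congr (q _).
  by apply/ffunP => i; rewrite !ffunE scalerDr.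
- move=> a x z; rewrite (hE (fun i => a * c x i)).
    by rewrite -linearZZ; congr (q _); apply/ffunP => i; rewrite !ffunE scalerA.
  under eq_bigr => i _ do rewrite -scalerA.
  by rewrite -scaler_sumr -cE.
- move=> a x z; rewrite -linearZZ; congr (q _).
  by apply/ffunP => i; rewrite !ffunE !scalerA mulrC.
have: f (\sum_i tens (g i) (m i)) = 0 by rewrite m0 raddf0.
rewrite linear_sum.
have -> : \sum_i f (tens (g i) (m i)) = q [ffun i => m i].
  transitivity (q (\sum_i [ffun j => (j == i)%:R *: m i])).
    rewrite linear_sum; apply: eq_bigr => i _; rewrite fE; apply: hE.
    rewrite (bigD1 i) //= eqxx scale1r big1 ?addr0 // => j /negPf->.
    by rewrite scale0r.
  congr (q _); apply/ffunP => j; rewrite sum_ffunE ffunE (bigD1 j) //=.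
  rewrite ffunE eqxx scale1r big1 ?addr0 // => i; rewrite ffunE eq_sym => /negPf->.
  by rewrite scale0r.
move=> /qP[k [b [y [bg E]]]]; exists k, b, y; split=> // i.
by rewrite -E ffunE.
Qed.

(** A relation with coefficients [a i] is a tensor over the ideal they generate with zero image in R
    ⊗ M; an element of [S] kills this tensor exactly when the relation is trivial up to a factor in
    [S]. *)
Lemma S_flatP : S_flat S M <-> eqflat.
Proof.
split=> [fl n a m _ am0|fl I [n [g gP]]].
  pose I : submodClosed R^o := span_pred (fun x : R^o => exists i, x = a i).
  have aI i : a i \in I by apply: mem_span; exists i.
  pose a' i : submodule I := Submodule (aI i).
  have sumE (d : 'I_n -> R) : val (\sum_i d i *: a' i) = \sum_i d i * a i.
    by rewrite (linear_sum (submodule_incl I)).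
  have gen (x : submodule I) : exists c : 'I_n -> R, x = \sum_i c i *: a' i.
    case: x => x xI; have /asboolP[s [sP xE]] := xI.
    suff [c cE] : exists c : 'I_n -> R, x = \sum_i c i * a i.
      by exists c; apply/val_inj; rewrite sumE.
    rewrite {xI}xE; elim: s sP => [|[r z] s IHs] sP.
      by exists (fun _ => 0); rewrite big_nil big1 // => i _; rewrite mul0r.
    have [|c cE] := IHs; first by move=> p ps; apply: sP; rewrite inE ps orbT.
    have [/= i ->] : exists i, z = a i by apply: (sP (r, z)); rewrite inE eqxx.
    exists (fun j => r * (j == i)%:R + c j); rewrite big_cons cE /=.
    under [RHS]eq_bigr => j _ do rewrite mulrDl.
    rewrite big_split /=; congr (_ + _).
    rewrite (bigD1 i) //= eqxx mulr1 big1 ?addr0 // => j /negPf->.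
    by rewrite mulr0 mul0r.
  have fgI : fg_ideal I.
    exists n, a => x; split=> [xI|[c ->]].
      by have [c /(congr1 val)] := gen (Submodule xI); rewrite sumE; exists c.
    by rewrite -sumE; exact: valP.
  have /loc_map_inj/(_ (\sum_i tens (a' i) (m i))) := fl I fgI.
  rewrite linear_sum; case.
    under eq_bigr => i _ do rewrite /= tensor_map_tens.
    transitivity (\sum_i (tens (1 : R^o) (a i *: m i) : tensor R^o M)).
      apply: eq_bigr => i _; rewrite tensZr -tensZl; congr (tens _ _).
      by rewrite /= [RHS]mulr1.
    by rewrite -tens_sumr am0 -[X in tens _ X](scale0r 0) tensZr scale0r.
  move=> u uS; rewrite scaler_sumr; under eq_bigr => i _ do rewrite -tensZr.
  move=> /(tensor_ideal_vanish gen)[k [b [y [ba mE]]]].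
  exists u, k, b, y; split=> // [j|i]; last by rewrite mE subrr.
  by rewrite -[RHS](congr1 val (ba j)) sumE; apply: eq_bigr => i _; rewrite mulrC.
apply/loc_map_inj => t t0.
have gI i : g i \in I.
  apply/gP; exists (fun j => (j == i)%:R); rewrite (bigD1 i) //= eqxx mul1r.
  by rewrite big1 ?addr0 // => j /negPf->; rewrite mul0r.
pose g' i : submodule I := Submodule (gI i).
have sumE (d : 'I_n -> R) : val (\sum_i d i *: g' i) = \sum_i d i * g i.
  by rewrite (linear_sum (submodule_incl I)).
have [m mE] : exists m : 'I_n -> M, t = \sum_i tens (g' i) (m i).
  have [s ->] := tensor_repr t; elim: s => [|[x z] s [m mE]].
    exists (fun _ => 0); rewrite big_nil big1 // => i _.
    by rewrite -[X in tens _ X](scale0r 0) tensZr scale0r.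
  have [c cE] := (gP (val x)).1 (valP x).
  exists (fun i => c i *: z + m i); rewrite big_cons mE /=.
  under [RHS]eq_bigr => i _ do rewrite tensDr tensZr -tensZl.
  rewrite big_split /= -tens_suml; congr (tens _ _ + _).
  by apply/val_inj; rewrite sumE.
have [mu muE] := tensor_ring_mul.
have gm0 : \sum_i g i *: m i = 0.
  have := congr1 mu t0; rewrite raddf0 mE !linear_sum => gm0.
  rewrite -[RHS]gm0; apply: eq_bigr => i _.
  by rewrite /= tensor_map_tens muE.
have [s [k [b [y [sS _ gb yE]]]]] := fl n g m (fun _ => Logic.I) gm0.
exists s => //; rewrite mE scaler_sumr.
(* Expanding [s *: m i] moves the matrix [b] to the ideal side, where each of its columns is a
   relation among the generators. *)
under eq_bigr => i _.
  rewrite -tensZr (subr0_eq (yE i)) tens_sumr.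
  under eq_bigr => j _ do rewrite tensZr -tensZl.
  over.
rewrite exchange_big big1 // => j _ /=; rewrite -tens_suml.
have -> : \sum_i b i j *: g' i = 0.
  apply/val_inj; rewrite sumE -[RHS](gb j).
  by apply: eq_bigr => i _; rewrite mulrC.
by rewrite -[X in tens X](scale0r 0) tensZl scale0r.
Qed.

End SFlatCriterion.

(** * Ext and extension of maps *)

Section ExtExtension.
Variables (R : comNzRingType) (F C : lmodType R).

Lemma augE (x : F) : aug F (free_gen R x) = x.
Proof. exact: free_lift_gen. Qed.

Lemma diff1E (z : ker (aug F)) : diff1 F (free_gen R z) = ker_incl (aug F) z.
Proof. by rewrite /diff1 /= free_lift_gen. Qed.

Lemma kerP (V W : lmodType R) (f : {linear V -> W}) x :
  f x = 0 <-> exists z : ker f, ker_incl f z = x.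
Proof.
split=> [/eqP fx0|[z <-]]; last by apply/eqP; have := valP z.
by exists (Submodule (fx0 : x \in ker_pred f)).
Qed.

(** Lifting [aug] to [s : res0 F -> X] and restricting to kernels gives [y]; the cocycle induced by
    [phi \o y] is the coboundary of some [g], and s u + j y' |-> g u + phi y' is the extension. *)
Lemma Ext1_trivial_extend (Y X : lmodType R) (j : {linear Y -> X})
    (p : {linear X -> F}) (phi : {linear Y -> C}) :
    short_exact j p -> Ext1_trivial F C ->
  exists Phi : {linear X -> C}, forall y, Phi (j y) = phi y.
Proof.
move=> [jinj pj psurj] ext0.
have /choice[sg sgP] := psurj.
have [s sE] := ex_free_lift sg.
have psE : p \o s =1 aug F.
  by apply: free_ext => x; rewrite /= sE sgP augE.
have [| | |y yP] := @ex_linear_rel R (ker (aug F)) Y (fun z y => j y = s (ker_incl _ z)).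
- by move=> z; apply/pj; rewrite -[p _]/((p \o s) _) psE; apply/kerP; exists z.
- by move=> z y y' <- /jinj.
- by move=> a z y z' y' E E'; rewrite linearP E E' -linearP -linearP.
have [f0 f0E] := ex_free_lift y.
have f0d1 u : diff1 F u = 0 -> f0 u = 0.
  have -> : f0 u = y (free_lift (fun z : ker (aug F) => z) u).
    apply: (@free_ext R _ _ f0 (y \o free_lift (fun z : ker (aug F) => z))) => z.
    by rewrite f0E /= free_lift_gen.
  move=> E; suff -> : free_lift (fun z : ker (aug F) => z) u = 0 by rewrite raddf0.
  by apply/val_inj.
have coc : (phi \o f0 : res1 F -> C) \in @cocycle_pred R F C.
  apply/asboolP; split=> [a u v|z]; first by rewrite linearP.
  rewrite /= f0d1 ?raddf0 //; apply/kerP.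
  by exists (free_lift (fun x : ker (diff1 F) => x) z).
pose f1 : cocycles F C := Submodule coc.
have := ext0 (quotmod_proj (@coboundary_pred R F C) f1).
rewrite -(raddf0 (quotmod_proj _)) => /quotmod_eqP; rewrite subr0.
move=> /asboolP[g gE].
have {}gE z : g (ker_incl (aug F) z) = phi (y z).
  by rewrite -diff1E -f0E; have /(congr1 (fun h => h (free_gen R z))) := gE.
(* Well defined: two decompositions of [x] differ by an element of [ker (aug F)], where [g] agrees
   with [phi \o y]. *)
have [| | |Phi PhiP] := @ex_linear_rel R X C (fun x c => exists u y',
    [/\ aug F u = p x, x = s u + j y' & c = g u + phi y']).
- move=> x; pose u := free_gen R (p x) : res0 F.
  have [y' y'E] : exists y', j y' = x - s u.
    by apply/pj; rewrite linearB -[p (s u)]/((p \o s) u) psE augE subrr.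
  exists (g u + phi y'), u, y'; split=> //; first by rewrite augE.
  by rewrite y'E addrC subrK.
- move=> x c c' [u [v [uE xE ->]]] [u' [v' [u'E xE' ->]]].
  have /kerP[z zE] : aug F (u - u') = 0 by rewrite linearB uE u'E subrr.
  apply/eqP; rewrite -subr_eq0 opprD addrACA -linearB -zE gE -linearB -linearD.
  suff -> : y z + (v - v') = 0 by rewrite raddf0.
  apply: jinj; rewrite raddf0 linearD yP zE !linearB addrACA -opprD -xE -xE'.
  exact: subrr.
- move=> a x c x' c' [u [v [uE xE ->]]] [u' [v' [u'E xE' ->]]].
  exists (a *: u + u'), (a *: v + v'); split.
  + by rewrite [LHS]linearP uE u'E [RHS]linearP.
  + by rewrite xE xE' !linearP scalerDr addrACA.
  + by rewrite !linearP scalerDr addrACA.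
exists Phi => y0; have [u [v [uE E ->]]] := PhiP (j y0).
have /kerP[z zE] : aug F u = 0 by rewrite uE; apply/pj; exists y0.
rewrite -zE gE -linearD; congr (phi _); apply: jinj.
by rewrite linearD yP zE E.
Qed.

(** A cocycle vanishes on the image of [diff2], which is the kernel of [diff1], so it descends to
    [ker (aug F)]; extending the result to [res0 F] gives a bounding cochain. *)
Lemma Ext1_trivial_of_extend :
    (forall phi : {linear ker (aug F) -> C},
       exists Phi : {linear res0 F -> C}, forall z, Phi (ker_incl (aug F) z) = phi z) ->
  Ext1_trivial F C.
Proof.
move=> ext x; rewrite -[x]quotmod_projK; case: (repr x) => f fcoc.
rewrite -(raddf0 (quotmod_proj _)); apply/quotmod_eqP; rewrite subr0.
have /asboolP[lf fd2] := fcoc.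
have [f' f'E] := ex_linear lf.
have fd1 u : diff1 F u = 0 -> f' u = 0.
  move=> /kerP[z <-]; rewrite f'E -(fd2 (free_gen R z)); congr (f _).
  by rewrite /diff2 /= free_lift_gen.
have [|phi phiE] := @ex_linear R (ker (aug F)) C (fun z => f' (free_gen R z)).
  move=> a z z'; apply/eqP; rewrite -subr_eq0 -linearP -linearB; apply/eqP/fd1.
  by rewrite linearB linearP !diff1E linearP subrr.
have [Phi PhiE] := ext phi.
apply/asboolP; exists Phi; apply/funext => u /=; rewrite -f'E.
apply: (@free_ext R _ _ f' (Phi \o diff1 F)) => z.
by rewrite -phiE -PhiE -diff1E.
Qed.

End ExtExtension.

(** * Small lifting problems suffice *)

Section ZornChains.
Local Open Scope classical_set_scope.

(** The union of the empty chain is empty, so [P] is weakened to [Q], which admits the empty set;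
    comparison with [A0] restores [P]. *)
Lemma Zorn_nonempty_chains T (P : set (set T)) A0 : P A0 ->
    (forall F : set (set T), F `<=` P -> total_on F subset -> (exists X, F X) ->
       P (\bigcup_(X in F) X)) ->
  exists A, P A /\ forall B, A `<=` B -> P B -> B = A.
Proof.
move=> PA0 Pchain; pose Q X := P X \/ X = set0.
have [F FQ Ftot|A [QA Amax]] := @Zorn_bigcup T Q.
  have [[X FX PX]|noP] := pselect (exists2 X, F X & P X); last first.
    right; apply/seteqP; split=> // x [X FX Xx]; case: (FQ X FX) => [PX|X0].
      by case: noP; exists X.
    by rewrite X0 in Xx.
  left; rewrite (_ : \bigcup_(X in F) X = \bigcup_(X in F `&` P) X).
    apply: Pchain => [Y []//|Y Z [FY _] [FZ _]|]; first exact: Ftot.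
    by exists X.
  apply/seteqP; split=> x [Y]; last by move=> [FY _] Yx; exists Y.
  by move=> FY Yx; exists Y => //; split=> //; case: (FQ Y FY) Yx => // ->.
have maxQ B : A `<=` B -> Q B -> B = A.
  move=> AB QB; apply/seteqP; split=> //; have [//|BA] := pselect (B `<=` A).
  by case: (Amax B).
case: QA => [PA|A_0]; first by exists A; split=> // B AB PB; apply: maxQ => //; left.
have A0E : A0 = A by apply: maxQ; [rewrite A_0; exact: sub0set | left].
by exists A; split=> [|B AB PB]; [rewrite -A0E | apply: maxQ => //; left].
Qed.

End ZornChains.

(* Closing one element under the operations of an R-module and under chosen
   solutions of single linear equations; its size depends on R only. *)
Inductive term (R : Type) : Type :=
| TGen
| TAdd of term R & term R
| TScale of R & term R
| TSolve n of 'I_n -> R & 'I_n & term R.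

HB.instance Definition _ (R : Type) := gen_eqMixin (term R).
HB.instance Definition _ (R : Type) := gen_choiceMixin (term R).

Section SmallClosure.
Variables (R : comNzRingType) (S : mulrClosed R) (Y : lmodType R) (D : Y -> Prop).

(** In use, [w n a z] is a chosen solution of [\sum_i a i *: x i = z] modulo [D]. *)
Fixpoint term_eval (w : forall n, ('I_n -> R) -> Y -> 'I_n -> Y) (y : Y) (t : term R) : Y :=
  match t with
  | TGen => y
  | TAdd t1 t2 => term_eval w y t1 + term_eval w y t2
  | TScale a t1 => a *: term_eval w y t1
  | TSolve n a i t1 => w n a (term_eval w y t1) i
  end.

(** The closure is pure: if [\sum_i a i *: m i] is [tau t] modulo [D], the chosen solution [x] lies
    in the closure, and the differences [m i - x i] satisfy a homogeneous equation modulo [D], to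
    which [flD] applies. *)
Lemma ex_small_closure (y : Y) : subspace D -> rel_flat S (fun=> True) D ->
  exists tau : term R -> Y, [/\ exists t, tau t = y,
    forall x, D x -> exists t, D (x - tau t),
    subspace (fun x => exists t, D (x - tau t))
    & rel_flat S (fun=> True) (fun x => exists t, D (x - tau t))].
Proof.
move=> sD flD.
have wex (p : {n & (('I_n -> R) * Y)%type}) : exists x : 'I_(projT1 p) -> Y,
    (exists x', D (\sum_i (projT2 p).1 i *: x' i - (projT2 p).2)) ->
    D (\sum_i (projT2 p).1 i *: x i - (projT2 p).2).
  have [[x' Dx']|no] := pselect (exists x' : 'I_(projT1 p) -> Y,
      D (\sum_i (projT2 p).1 i *: x' i - (projT2 p).2)); first by exists x'.
  by exists (fun=> 0) => /no.
pose w' n (a : 'I_n -> R) z := sval (cid (wex (existT _ n (a, z)))).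
pose tau := term_eval w' y.
have sD' : subspace (fun x => exists t, D (x - tau t)).
  split=> [|a x x' [t Dt] [t' Dt']].
    by exists (TScale 0 (TGen R)); rewrite /tau /= scale0r subrr; exact: subspace0.
  exists (TAdd (TScale a t) t'); rewrite /tau /= opprD addrACA -scalerBr.
  exact: sD.2.
exists tau; split=> //; first by exists (TGen R).
  by move=> x Dx; exists (TScale 0 (TGen R)); rewrite /tau /= scale0r subr0.
move=> n a m _ [t Dt].
pose x i := tau (TSolve a i t).
have Dx : D (\sum_i a i *: x i - tau t).
  by apply: (svalP (cid (wex (existT _ n (a, tau t))))); exists m.
have [|s [k [b [z [sS _ ab Dz]]]]] := flD n a (fun i => m i - x i) (fun=> Logic.I).
  under eq_bigr => i _ do rewrite scalerBr.
  rewrite sumrB (_ : _ - _ = \sum_i a i *: m i - tau t - (\sum_i a i *: x i - tau t)).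
    exact: subspaceB.
  by rewrite opprB addrA subrK.
exists s, k, b, z; split=> // i; exists (TScale s (TSolve a i t)).
by rewrite addrAC -scalerBr.
Qed.

End SmallClosure.

(** * The right lifting property and its reduction to one free module *)

Section Lifting.
Local Open Scope classical_set_scope.
Variables (R : comNzRingType) (S : mulrClosed R).
Implicit Types A B X Y : lmodType R.

Definition SF_mono A X (i : {linear A -> X}) : Prop :=
  injective i /\ rel_flat S (fun=> True) (fun x => exists a, i a = x).

Definition has_rlp X B (pi : {linear X -> B}) : Prop :=
  forall A Y (j : {linear A -> Y}) (f : {linear A -> X}) (h : {linear Y -> B}),
    SF_mono j -> (forall a, pi (f a) = h (j a)) ->
  exists g : {linear Y -> X}, (forall a, g (j a) = f a) /\ forall y, pi (g y) = h y.

Definition small : lmodType R := free R (term R).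

(** [phi] is a plain function, linear on [N] only: a partial map that requires no module structure
    on [N] and whose values can be coded in a label. *)
Definition has_small_rlp X B (pi : {linear X -> B}) : Prop :=
  forall (N : small -> Prop) (phi : small -> X) (psi : {linear small -> B}),
    subspace N -> rel_flat S (fun=> True) N ->
    (forall a u v, N u -> N v -> phi (a *: u + v) = a *: phi u + phi v) ->
    (forall u, N u -> pi (phi u) = psi u) ->
  exists g : {linear small -> X},
    (forall u, N u -> g u = phi u) /\ forall u, pi (g u) = psi u.

(** Zorn's lemma on graphs [G] of partial solutions with [Y / dom G] S-flat. The closure of any [y]
    over [dom G] is covered by [small], and solving the small problem on the preimage [N] of [dom G]
    prolongs [G] to [y]. *)
Lemma has_small_rlpW X B (pi : {linear X -> B}) : has_small_rlp pi -> has_rlp pi.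
Proof.
move=> rlp A Y j f h [jinj flj] fh.
pose dom (G : set (Y * X)) : set Y := fun y => exists x, G (y, x).
pose P (G : set (Y * X)) := [/\ subspace G, forall a, G (j a, f a),
  forall x, G (0, x) -> x = 0, forall p, G p -> pi p.2 = h p.1
  & rel_flat S (fun=> True) (dom G)].
have sdom G : subspace G -> subspace (dom G).
  move=> sG; split=> [|a y y' [x Gx] [x' Gx']].
    by exists 0; exact: sG.1.
  by exists (a *: x + x'); exact: (sG.2 a (y, x) (y', x')).
have Gfun G y x x' : P G -> G (y, x) -> G (y, x') -> x = x'.
  move=> [sG _ G0 _ _] Gx Gx'; apply/eqP; rewrite -subr_eq0; apply/eqP/G0.
  by rewrite -(subrr y); exact: (subspaceB sG Gx Gx').
have [| |G [PG Gmax]] := @Zorn_nonempty_chains _ P (fun p => exists a, (j a, f a) = p).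
- split.
  + split=> [|c _ _ [a <-] [a' <-]]; first by exists 0; rewrite !raddf0.
    by exists (c *: a + a'); rewrite !linearP.
  + by move=> a; exists a.
  + by move=> x [a [ja0 <-]]; rewrite (jinj a 0) ?raddf0.
  + by move=> _ [a <-]; exact: fh.
  + suff -> : dom (fun p => exists a, (j a, f a) = p) = (fun y => exists a, j a = y) by [].
    by apply/seteqP; split=> y [] => [x [a [<- _]]|a <-]; [exists a | exists (f a), a].
- move=> F FP Ftot [G0 FG0].
  have FU p q : (\bigcup_(G in F) G) p -> (\bigcup_(G in F) G) q ->
      exists G, [/\ F G, G p & G q].
    move=> [G FG Gp] [G' FG' Gq]; case: (Ftot G G' FG FG') => GG'.
      by exists G'; split=> //; exact: GG'.
    by exists G; split=> //; exact: GG'.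
  split.
  + split=> [|a p q pF qF]; first by exists G0 => //; case: (FP _ FG0) => /subspace0.
    have [G [FG Gp Gq]] := FU p q pF qF.
    by exists G => //; case: (FP _ FG) => sG *; exact: sG.2.
  + by move=> a; exists G0 => //; case: (FP _ FG0).
  + by move=> x [G FG Gx]; case: (FP _ FG) => _ _ G0' _ _; exact: G0'.
  + by move=> p [G FG Gp]; case: (FP _ FG) => _ _ _ Gh _; exact: Gh.
  + move=> n a m _ [x [G FG Gx]]; case: (FP _ FG) => _ _ _ _ flG.
    have [|s [k [b [y [sS _ ab Gy]]]]] := flG n a m (fun=> Logic.I); first by exists x.
    by exists s, k, b, y; split=> // i; have [z] := Gy i; exists z, G.
have [sG Gj G0 Gh flG] := PG.
suff Gtot y : dom G y.
  have [| | |g gP] := @ex_linear_rel R Y X (fun y x => G (y, x)).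
  - exact: Gtot.
  - by move=> y x x'; exact: Gfun.
  - by move=> a y x y' x'; exact: (sG.2 a (y, x) (y', x')).
  exists g; split=> [a|y']; last exact: (Gh _ (gP y')).
  exact: (Gfun _ _ _ _ PG (gP _) (Gj a)).
have sdG := sdom G sG.
have [tau [[ty tyE] GD' sD' flD']] := ex_small_closure y sdG flG.
have [q qE] := ex_free_lift tau.
pose D' x := exists t, dom G (x - tau t).
have qD' u : D' (q u).
  have [s ->] := free_repr u; rewrite linear_sum; apply: subspace_sum => // p _.
  rewrite (linearZZ q) qE; apply: subspaceZ => //.
  by exists p.2; rewrite subrr; exact: subspace0.
pose N u := dom G (q u).
have sN : subspace N.
  by split=> [|a u v Nu Nv]; rewrite /N ?raddf0 ?linearP; [exact: subspace0 | exact: sdG.2].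
(* [small / N] is isomorphic to [D' / dom G], the kernel of the surjection of S-flat modules from
   [Y / dom G] to [Y / D']. *)
have flN : rel_flat S (fun=> True) N.
  apply: (@rel_flat_transport R S _ _ q (fun=> True) N D' (dom G) _ sD' sdG _ _ _).2 => //.
    by move=> z [t Dt]; exists (free_gen R t); rewrite ?qE.
  exact: (@rel_flat_sub _ _ _ (fun=> True)).
have /choice[phi phiP] u : exists x, N u -> G (q u, x).
  by have [[x Gx]|//] := pselect (N u); [exists x | exists 0].
have [||g [gN gh]] := rlp N phi (h \o q) sN flN.
- move=> a u v Nu Nv; apply: (Gfun _ _ _ _ PG); first exact/phiP/sN.2.
  by rewrite linearP; exact: (sG.2 a (_, _) (_, _) (phiP u Nu) (phiP v Nv)).
- by move=> u Nu; exact: (Gh _ (phiP u Nu)).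
pose G' (p : Y * X) := exists p0 u, G p0 /\ p = p0 + (q u, g u).
have GG' : G `<=` G'.
  by move=> p Gp; exists p, 0; rewrite !raddf0; split=> //; rewrite -[LHS]addr0.
rewrite -(Gmax G' GG'); last first.
  split.
  - split=> [|a _ _ [p [u [Gp ->]]] [p' [u' [Gp' ->]]]]; first exact/GG'/sG.1.
    exists (a *: p + p'), (a *: u + u'); split; first exact: sG.2.
    by rewrite !linearP scalerDr addrACA.
  - by move=> a; exact/GG'.
  (* Single-valuedness: [G] and the graph of [(q, g)] overlap only over [N], where they agree. *)
  - move=> x [[y0 x0] [u [Gp [yE ->]]]].
    have qu : q (- u) = y0 by rewrite raddfN; apply/eqP; rewrite eq_sym -addr_eq0 -yE.
    have Nu : N (- u) by exists x0; rewrite qu.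
    have -> : x0 = g (- u).
      by rewrite gN //; apply: (Gfun _ y0 _ _ PG) => //; rewrite -qu; exact: phiP.
    by rewrite raddfN addNr.
  - by move=> _ [p [u [Gp ->]]] /=; rewrite !linearD Gh ?gh.
  - suff -> : dom G' = D' by [].
    apply/seteqP; split=> z [].
      move=> x [[y0 x0] [u [Gp [-> _]]]]; apply: subspaceD => //.
      by apply: GD'; exists x0.
    move=> t [x0 Gx0]; exists (x0 + g (free_gen R t)), (z - tau t, x0), (free_gen R t).
    by split=> //; rewrite qE; congr (_, _); rewrite subrK.
exists (0 + g (free_gen R ty)), 0, (free_gen R ty); split; first exact: sG.1.
by rewrite qE tyE; congr (_, _); rewrite add0r.
Qed.

End Lifting.

(** * Factorizations presented by labelled generators *)

(** The larger of two stages is taken finitely often; finite supports and finite families thus pass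
    through unions of chains. *)
Lemma chain_seq_bound (I : Type) (le : I -> I -> Prop) (T : eqType) (P : I -> T -> Prop) (i0 : I) :
    (forall i j, le i j \/ le j i) -> (forall i j t, le i j -> P i t -> P j t) ->
  forall s : seq T, (forall t, t \in s -> exists i, P i t) ->
    exists i, forall t, t \in s -> P i t.
Proof.
move=> tot mono; elim=> [|t s IHs] sP; first by exists i0.
have [|i iP] := IHs; first by move=> t' t's; apply: sP; rewrite inE t's orbT.
have [|j jP] := sP t; first by rewrite inE eqxx.
case: (tot i j) => ij; [exists j | exists i] => t'; rewrite inE => /orP[/eqP->|t's] //.
- exact: (mono i j t' ij (iP t' t's)).
- exact: (mono j i t ij jP).
- exact: iP.
Qed.

Section Objects.
Local Open Scope classical_set_scope.
Variables (R : comNzRingType) (S : mulrClosed R) (A B : lmodType R) (c : {linear A -> B}).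
Implicit Types X Y : lmodType R.

(* Factorizations A -> X -> B of c whose first factor is an S-flat extension.
   S-flat modules over B are the case A = 0, S-flat extensions of A the case B = 0. *)
Definition is_obj X (i : {linear A -> X}) (pi : {linear X -> B}) : Prop :=
  SF_mono S i /\ forall a, pi (i a) = c a.

Definition is_mor X (i : {linear A -> X}) (pi : {linear X -> B})
    Y (j : {linear A -> Y}) (rho : {linear Y -> B}) (f : {linear X -> Y}) : Prop :=
  (forall a, f (i a) = j a) /\ forall x, rho (f x) = pi x.

Lemma is_mor_comp X (i : {linear A -> X}) (pi : {linear X -> B})
    Y (j : {linear A -> Y}) (rho : {linear Y -> B})
    (Z : lmodType R) (k : {linear A -> Z}) (sg : {linear Z -> B})
    (f : {linear X -> Y}) (g : {linear Y -> Z}) :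
  is_mor i pi j rho f -> is_mor j rho k sg g -> is_mor i pi k sg (g \o f).
Proof. by move=> [fi fpi] [gj grho]; split=> [a|x] /=; rewrite ?fi ?gj ?grho ?fpi. Qed.

Definition weakly_terminal X (i : {linear A -> X}) (pi : {linear X -> B}) : Prop :=
  is_obj i pi /\ forall Y (j : {linear A -> Y}) (rho : {linear Y -> B}), is_obj j rho ->
    exists f, is_mor j rho i pi f.

Lemma SF_mono_id : SF_mono S (idfun : {linear A -> A}).
Proof.
split=> // n a m _ _; exists 1, 0%N, (fun _ _ => 0), (fun=> 0).
by split=> [|[]|[]|i] //; [exact: rpred1 | eexists].
Qed.

(** * Ambient modules and the pairs (L, K) that present objects *)

Section Ambient.
Variables (Lam W : choiceType).

Definition amb : lmodType R := (A * free R (Lam * W)%type)%type.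

Definition inA (a : A) : amb := (a, 0).

Lemma inA_linear : linear inA.
Proof. by move=> a x y; rewrite /inA; congr (_, _); rewrite /= scaler0 addr0. Qed.
HB.instance Definition _ := GRing.isLinear.Build R A amb _ inA inA_linear.

Definition gen (l : Lam) (w : W) : amb := (0, free_gen R (l, w)).

Lemma amb_repr (x : amb) (s : seq (R * (Lam * W))) :
    x.2 = \sum_(p <- s) p.1 *: free_gen R p.2 ->
  x = inA x.1 + \sum_(p <- s) p.1 *: gen p.2.1 p.2.2.
Proof.
move=> xE; have -> : \sum_(p <- s) p.1 *: gen p.2.1 p.2.2 = (0, x.2) :> amb.
  rewrite xE; elim: s {xE} => [|[r [l w]] s IHs]; first by rewrite !big_nil.
  by rewrite !big_cons IHs; congr (_, _); rewrite /= scaler0 addr0.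
by case: x {xE} => a u; congr (_, _); rewrite /= ?addr0 ?add0r.
Qed.

Lemma ex_amb_lift (Y : lmodType R) (f : {linear A -> Y}) (w : Lam -> W -> Y) :
  exists g : {linear amb -> Y}, (forall a, g (inA a) = f a) /\ forall l t, g (gen l t) = w l t.
Proof.
have [h hE] := ex_free_lift (fun p : Lam * W => w p.1 p.2).
have [g gE] : exists g : {linear amb -> Y}, g =1 fun x => f x.1 + h x.2.
  by apply: ex_linear => a x y; rewrite /= !linearP scalerDr addrACA.
by exists g; split=> [a|l t]; rewrite gE /= ?hE raddf0 ?addr0 ?add0r.
Qed.

(** Only the free component is constrained, so [A] is supported on every [L]. *)
Definition supported (L : set Lam) (x : amb) : Prop := exists s : seq (R * (Lam * W)),
  (forall p, p \in s -> L p.2.1) /\ x.2 = \sum_(p <- s) p.1 *: free_gen R p.2.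

Lemma supported_subspace L : subspace (supported L).
Proof.
split=> [|a x y [s [sL sE]] [s' [s'L s'E]]]; first by exists [::]; rewrite big_nil.
exists ([seq (a * p.1, p.2) | p <- s] ++ s'); split=> [p|].
  by rewrite mem_cat => /orP[/mapP[p' p's ->]|/s'L//]; exact: (sL p').
rewrite big_cat big_map -[LHS]/(a *: x.2 + y.2) sE s'E scaler_sumr; congr (_ + _).
by apply: eq_bigr => p _; rewrite scalerA.
Qed.

Lemma supportedS L L' : L `<=` L' -> supported L `<=` supported L'.
Proof. by move=> LL' x [s [sL sE]]; exists s; split=> // p /sL /LL'. Qed.

Lemma supported_inA L a : supported L (inA a).
Proof. by exists [::]; rewrite big_nil. Qed.

Lemma supported_gen (L : set Lam) l t : L l -> supported L (gen l t).
Proof.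
move=> Ll; exists [:: (1, (l, t))]; rewrite big_seq1 scale1r; split=> // p.
by rewrite mem_seq1 => /eqP->.
Qed.

Lemma supported_ext (L : set Lam) (Y : lmodType R) (f g : {linear amb -> Y}) :
    (forall a, f (inA a) = g (inA a)) ->
    (forall l t, L l -> f (gen l t) = g (gen l t)) ->
  forall x, supported L x -> f x = g x.
Proof.
move=> fgA fgL x [s [sL /amb_repr->]]; rewrite !linearD fgA !linear_sum; congr (_ + _).
rewrite big_seq [RHS]big_seq; apply: eq_bigr => p ps.
by rewrite (linearZZ f) (linearZZ g) fgL //; exact: sL.
Qed.

Lemma supported_set0 x : supported set0 x -> x = inA x.1.
Proof.
move=> [s [s0 /amb_repr ->]]; suff -> : s = [::] by rewrite big_nil addr0.
by case: s s0 => // p s /(_ p); rewrite inE eqxx => /(_ isT).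
Qed.

Lemma supported_chain (I : Type) (i0 : I) (Ls : I -> set Lam) x :
    (forall i j, Ls i `<=` Ls j \/ Ls j `<=` Ls i) ->
  supported (\bigcup_i Ls i) x -> exists i, supported (Ls i) x.
Proof.
move=> tot [s [sL xE]].
have [||i iP] := @chain_seq_bound I (fun i j => Ls i `<=` Ls j) _
  (fun i (p : R * (Lam * W)) => Ls i p.2.1) i0 tot _ s.
- by move=> i j p /[apply].
- by move=> p /sL[i _ Lp]; exists i.
by exists i, s.
Qed.

(** Blocks outside [L] are killed; a quotient of [supported L] can then be formed as a quotient of
    all of [amb]. *)
Lemma ex_supported_retraction (L : set Lam) : exists r : {linear amb -> amb},
  (forall x, supported L (r x)) /\ forall x, supported L x -> r x = x.
Proof.
have [r [rA rE]] := ex_amb_lift inA (fun l t => if `[< L l >] then gen l t else 0).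
have sL := supported_subspace L.
exists r; split=> [x|]; last first.
  by apply: (@supported_ext L amb r idfun) => // l t Ll; rewrite rE asboolT.
have [s /amb_repr->] := free_repr x.2; rewrite linearD linear_sum rA.
apply: subspaceD => //; first exact: supported_inA.
apply: subspace_sum => // p _; rewrite (linearZZ r) rE; apply: subspaceZ => //.
by case: asboolP => [Ll|_]; [exact: supported_gen | exact: subspace0].
Qed.

Variable tau : {linear amb -> B}.
Hypothesis tauA : forall a, tau (inA a) = c a.

(** Says that [supported L] modulo [K] is an object: [tau] descends to it, [A] embeds, and the
    cokernel, [supported L] modulo [K + A], is S-flat. *)
Definition good (L : set Lam) (K : set amb) : Prop :=
  [/\ subspace K, K `<=` supported L, forall x, K x -> tau x = 0,
    forall a, K (inA a) -> a = 0
    & rel_flat S (supported L) (fun x => exists a, K (x - inA a))].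

Definition presents (L : set Lam) (K : set amb) X (i : {linear A -> X})
    (pi : {linear X -> B}) (q : {linear amb -> X}) : Prop :=
  [/\ forall a, q (inA a) = i a, forall x, K x <-> supported L x /\ q x = 0,
    forall z, exists2 x, supported L x & q x = z
    & forall x, supported L x -> pi (q x) = tau x].

Lemma presents_flat L K X (i : {linear A -> X}) (pi : {linear X -> B}) q :
    presents L K i pi q ->
  rel_flat S (supported L) (fun x => exists a, K (x - inA a)) <->
  rel_flat S (fun=> True) (fun x => exists a, i a = x).
Proof.
move=> [qA Kq qsurj qpi]; have sL := supported_subspace L.
apply: (@rel_flat_transport R S _ _ q) => //.
- exact: subspace_im.
- move=> x Lx; split=> [[a /Kq[_ E]]|[a E]]; exists a.
    by apply/eqP; rewrite eq_sym -subr_eq0 -qA -linearB E.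
  apply/Kq; split; last by rewrite linearB qA E subrr.
  by apply: subspaceB => //; exact: supported_inA.
- by move=> z _; have [x Lx <-] := qsurj z; exists x => //; exists 0; rewrite raddf0 subrr.
Qed.

Lemma good_presents L K : good L K ->
  exists (X : lmodType R) (i : {linear A -> X}) (pi : {linear X -> B})
    (q : {linear amb -> X}), is_obj i pi /\ presents L K i pi q.
Proof.
move=> [sK KL Ktau KA flK].
have [r [rL rid]] := ex_supported_retraction L.
have [|X [q [qP qsurj]]] := @ex_quotient R amb (fun x => K (r x)).
  by split=> [|a x y Kx Ky]; rewrite ?raddf0 ?linearP; [exact: sK.1 | exact: sK.2].
have [||pi piE] := @quotient_factor R amb X B q (tau \o r) => //.
  by move=> x /qP/Ktau.
have pres : presents L K (q \o inA) pi q.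
  split=> // [x|z|x Lx]; last by rewrite piE /= rid.
  - split=> [Kx|[Lx /qP]]; last by rewrite rid.
    by split; [exact: KL | apply/qP; rewrite rid //; exact: KL].
  - have [x <-] := qsurj z; exists (r x) => //.
    apply/eqP; rewrite -subr_eq0 -linearB; apply/eqP/qP; rewrite (linearB r) (rid _ (rL x)) subrr.
    exact: sK.1.
exists X, (q \o inA), pi, q; split=> //; split=> [|a]; last first.
  by rewrite piE /= rid ?tauA //; exact: supported_inA.
split; last exact/(presents_flat pres).
move=> a a' /eqP; rewrite -subr_eq0 -linearB /= => /eqP/qP.
rewrite rid; last exact: supported_inA.
by move=> /KA/eqP; rewrite subr_eq0 => /eqP.
Qed.

Lemma presents_good L X (i : {linear A -> X}) (pi : {linear X -> B}) (q : {linear amb -> X}) :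
    is_obj i pi -> (forall a, q (inA a) = i a) ->
    (forall z, exists2 x, supported L x & q x = z) ->
    (forall x, supported L x -> pi (q x) = tau x) ->
  exists K, good L K /\ presents L K i pi q.
Proof.
move=> [[iinj fli] pii] qA qsurj qpi.
pose K x := supported L x /\ q x = 0.
have pres : presents L K i pi q by [].
have sL := supported_subspace L.
exists K; split=> //; split=> [|x []//|x [Lx qx]|a [_]|].
- split=> [|a x y [Lx qx] [Ly qy]]; first by split; [exact: sL.1 | rewrite raddf0].
  by split; [exact: sL.2 | rewrite linearP qx qy scaler0 addr0].
- by rewrite -qpi // qx raddf0.
- by rewrite qA => ia; apply: iinj; rewrite ia raddf0.
- exact/(presents_flat pres).
Qed.

(** Turns a morphism into an inclusion of pairs, against which maximality is played: old blocks go
    to [X'] through [f \o q], the fresh block [l] through [w], and [K'] is the resulting kernel. *)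
Lemma ex_extension L K X (i : {linear A -> X}) (pi : {linear X -> B}) q l
    (X' : lmodType R) (i' : {linear A -> X'}) (pi' : {linear X' -> B}) (f : {linear X -> X'})
    (w : {linear free R W -> X'}) :
    presents L K i pi q -> is_obj i' pi' -> ~ L l -> is_mor i pi i' pi' f ->
    (forall t, pi' (w (free_gen R t)) = tau (gen l t)) ->
    (forall z, exists x u, z = f x + w u) ->
  exists K' (q' : {linear amb -> X'}),
    [/\ good (L `|` [set l]) K', presents (L `|` [set l]) K' i' pi' q', K `<=` K',
      forall x, supported L x -> q' x = f (q x)
      & forall t, q' (gen l t) = w (free_gen R t)].
Proof.
move=> [qA Kq qsurj qpi] obj' Ll [fi fpi] wtau gen'.
have [q' [q'A q'E]] := ex_amb_lift i'
  (fun l' t => if l' == l then w (free_gen R t) else f (q (gen l' t))).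
have q'f x : supported L x -> q' x = f (q x).
  apply: (@supported_ext L _ q' (f \o q)) => [a|l' t Ll'] /=.
    by rewrite q'A qA fi.
  by rewrite q'E; case: eqP => // E; case: Ll; rewrite -E.
have q'l t : q' (gen l t) = w (free_gen R t) by rewrite q'E eqxx.
have LS : L `<=` L `|` [set l] by move=> ? ?; left.
have sL' := supported_subspace (L `|` [set l]).
have wsurj u : exists2 x, supported (L `|` [set l]) x & q' x = w u.
  have [s ->] := free_repr u; exists (\sum_(p <- s) p.1 *: gen l p.2).
    apply: subspace_sum => // p _; apply: subspaceZ => //; apply: supported_gen.
    by right.
  rewrite !linear_sum; apply: eq_bigr => p _.
  by rewrite (linearZZ q') (linearZZ w) q'l.
have [||K' [goodK' pres']] := @presents_good (L `|` [set l]) X' i' pi' q' obj' q'A.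
- move=> z; have [x [u ->]] := gen' z; have [y Ly <-] := qsurj x.
  have [y' Ly' <-] := wsurj u; exists (y + y'); last by rewrite linearD q'f.
  by apply: subspaceD => //; exact: supportedS Ly.
- apply: (@supported_ext _ _ (pi' \o q') tau) => [a|l' t []] /=.
  + by rewrite q'A obj'.2 tauA.
  + move=> Ll'; rewrite q'f ?fpi ?qpi //; exact: supported_gen.
  + by move=> ->; rewrite q'l wtau.
exists K', q'; split=> // x /Kq[Lx qx]; have [_ K'q _ _] := pres'; apply/K'q.
by split; [exact: supportedS Lx | rewrite q'f // qx raddf0].
Qed.

(** Every clause, flatness included, starts from finitely many elements, so each instance is settled
    at one stage. *)
Lemma good_chain (I : Type) (i0 : I) (Ls : I -> set Lam) (Ks : I -> set amb) :
    (forall i, good (Ls i) (Ks i)) ->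
    (forall i j, (Ls i `<=` Ls j /\ Ks i `<=` Ks j) \/ (Ls j `<=` Ls i /\ Ks j `<=` Ks i)) ->
  good (\bigcup_i Ls i) (\bigcup_i Ks i).
Proof.
move=> goodI tot; pose le i j := Ls i `<=` Ls j /\ Ks i `<=` Ks j.
have suppU x : supported (\bigcup_i Ls i) x -> exists i, supported (Ls i) x.
  by apply: supported_chain => // i j; case: (tot i j) => [[]|[]]; [left | right].
have KU x y : (\bigcup_i Ks i) x -> (\bigcup_i Ks i) y -> exists i, Ks i x /\ Ks i y.
  move=> [i _ Kx] [j _ Ky]; case: (tot i j) => [[_ KS]|[_ KS]]; [exists j | exists i];
    by split=> //; exact: KS.
split.
- split=> [|a x y Kx Ky]; first by exists i0 => //; have [[]] := goodI i0.
  by have [i [Kix Kiy]] := KU x y Kx Ky; exists i => //; have [sK *] := goodI i; exact: sK.2.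
- move=> x [i _ Kx]; have [_ KL _ _ _] := goodI i; apply: supportedS (KL x Kx).
  by move=> l Ll; exists i.
- by move=> x [i _ Kx]; have [_ _ Kt _ _] := goodI i; exact: Kt.
- by move=> a [i _ Ka]; have [_ _ _ KA _] := goodI i; exact: KA.
move=> n a m Lm [z [i _ Kz]].
have [||j jP] := @chain_seq_bound I le _ (fun i (k : 'I_n) => supported (Ls i) (m k)) i0 tot _
  (enum 'I_n).
- by move=> i1 i2 k [LS _]; exact: supportedS.
- by move=> k _; exact: suppU.
have [k [Lmk Kzk]] : exists k, (forall l, supported (Ls k) (m l)) /\
    Ks k (\sum_h a h *: m h - inA z).
  case: (tot i j) => [[_ KS]|[LS _]].
    by exists j; split=> [l|]; [apply: jP; rewrite mem_enum | exact: KS].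
  by exists i; split=> // l; apply: (supportedS LS); apply: jP; rewrite mem_enum.
have [_ _ _ _ flk] := goodI k.
have [|s [p [b [y [sS Ly ab Dy]]]]] := flk n a m Lmk; first by exists z.
exists s, p, b, y; split=> // [h|h].
  by apply: supportedS (Ly h) => l Ll; exists k.
by have [z' Kz'] := Dy h; exists z', k.
Qed.

(** For Zorn's lemma a pair is coded as one subset of [Lam + amb], starting from [A] itself with no
    labels; [Inv] is an invariant to be maintained along the way. *)
Lemma ex_maximal_good (Inv : set Lam -> set amb -> Prop) :
    (forall K, good set0 K -> (forall x, K x -> x = 0) -> Inv set0 K) ->
    (forall (I : Type) (i0 : I) (Ls : I -> set Lam) (Ks : I -> set amb),
      (forall i, good (Ls i) (Ks i)) -> (forall i, Inv (Ls i) (Ks i)) ->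
      (forall i j, (Ls i `<=` Ls j /\ Ks i `<=` Ks j) \/ (Ls j `<=` Ls i /\ Ks j `<=` Ks i)) ->
      Inv (\bigcup_i Ls i) (\bigcup_i Ks i)) ->
  exists L K, [/\ good L K, Inv L K & forall L' K', L `<=` L' -> K `<=` K' ->
    good L' K' -> Inv L' K' -> L' `<=` L].
Proof.
move=> Inv0 InvU.
pose Lof (Z : set (Lam + amb)) : set Lam := fun l => Z (inl l).
pose Kof (Z : set (Lam + amb)) : set amb := fun x => Z (inr x).
pose mk (L : set Lam) (K : set amb) : set (Lam + amb) :=
  fun z => match z with inl l => L l | inr x => K x end.
have [q0 [q0A _]] := @ex_amb_lift A idfun (fun _ _ => 0).
have [|||K0 [goodK0 [_ K0q _ _]]] := @presents_good set0 A idfun c q0 _ q0A.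
- by split=> //; exact: SF_mono_id.
- by move=> a; exists (inA a); [exact: supported_inA | rewrite q0A].
- by apply: (@supported_ext set0 _ (c \o q0) tau) => // a; rewrite /= q0A tauA.
have [||Z [[goodZ InvZ] Zmax]] := @Zorn_nonempty_chains _
    (fun Z => good (Lof Z) (Kof Z) /\ Inv (Lof Z) (Kof Z)) (mk set0 K0).
- split=> //; apply: Inv0 => // x /K0q[/supported_set0-> ].
  by rewrite q0A /= => ->; rewrite raddf0.
- move=> F FP Ftot [Z0 FZ0].
  pose I := {Z | F Z}.
  have LU : Lof (\bigcup_(Z in F) Z) = \bigcup_(i : I) Lof (sval i).
    apply/seteqP; split=> l; first by move=> [Z FZ Zl]; exists (exist _ Z FZ).
    by move=> [[Z FZ] _ Zl]; exists Z.
  have KU : Kof (\bigcup_(Z in F) Z) = \bigcup_(i : I) Kof (sval i).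
    apply/seteqP; split=> l; first by move=> [Z FZ Zl]; exists (exist _ Z FZ).
    by move=> [[Z FZ] _ Zl]; exists Z.
  rewrite LU KU.
  have tot (i j : I) : (Lof (sval i) `<=` Lof (sval j) /\ Kof (sval i) `<=` Kof (sval j)) \/
      (Lof (sval j) `<=` Lof (sval i) /\ Kof (sval j) `<=` Kof (sval i)).
    case: i j => [Z FZ] [Z' FZ'] /=.
    by case: (Ftot Z Z' FZ FZ') => ZZ'; [left | right]; split=> l; exact: ZZ'.
  have i0 : I by exists Z0.
  split.
    by apply: good_chain => // -[Z FZ]; case: (FP Z FZ).
  by apply: InvU => // -[Z FZ]; case: (FP Z FZ).
exists (Lof Z), (Kof Z); split=> // L' K' LL' KK' good' Inv'.
suff <- : mk L' K' = Z by [].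
by apply: Zmax => // -[l|x]; [exact: LL' | exact: KK'].
Qed.

End Ambient.

End Objects.

(** * Maximal presentations *)

Section Pushout.
Variables (R : comNzRingType) (S : mulrClosed R) (A B : lmodType R) (c : {linear A -> B}).
Variables (X G : lmodType R) (i : {linear A -> X}) (pi : {linear X -> B}).
Variables (N : G -> Prop) (phi : G -> X) (psi : {linear G -> B}).

(** [X'] is the quotient of [X * G] by the pairs [(- phi u, u)] with [u] in [N]; the filtration A,
    X, X' has the S-flat factors X / A and G / N. *)
Lemma ex_pushout : is_obj S c i pi -> subspace N -> rel_flat S (fun=> True) N ->
    (forall a u v, N u -> N v -> phi (a *: u + v) = a *: phi u + phi v) ->
    (forall u, N u -> pi (phi u) = psi u) ->
  exists (X' : lmodType R) (i' : {linear A -> X'}) (pi' : {linear X' -> B})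
      (f : {linear X -> X'}) (g : {linear G -> X'}),
    [/\ is_obj S c i' pi', is_mor i pi i' pi' f, forall u, N u -> g u = f (phi u),
      forall u, pi' (g u) = psi u & forall z, exists x u, z = f x + g u].
Proof.
move=> [[iinj fli] pii] sN flN phiL phipsi.
have N0 := sN.1.
have phi0 : phi 0 = 0.
  have := phiL 1 0 0 N0 N0; rewrite !scale1r addr0 => /eqP.
  by rewrite -subr_eq0 opprD addNKr oppr_eq0 => /eqP.
have phiN u : N u -> phi (- u) = - phi u.
  by move=> Nu; have := phiL (-1) u 0 Nu N0; rewrite phi0 !addr0 !scaleN1r.
pose XG : lmodType R := (X * G)%type.
have [|X' [q [qP qsurj]]] := @ex_quotient R XG (fun p => N p.2 /\ p.1 = - phi p.2).
  split=> [|a p p' [Np pE] [Np' p'E]]; first by rewrite /= phi0 oppr0.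
  split; first exact: sN.2.
  by rewrite /= phiL // pE p'E scalerN opprD.
have [f fE] : exists f : {linear X -> X'}, f =1 fun x => q (x, 0).
  apply: ex_linear => a x y; rewrite -linearP; congr (q _); congr (_, _).
  by rewrite /= scaler0 addr0.
have [g gE] : exists g : {linear G -> X'}, g =1 fun u => q (0, u).
  apply: ex_linear => a x y; rewrite -linearP; congr (q _); congr (_, _).
  by rewrite /= scaler0 addr0.
have qfg p : q p = f p.1 + g p.2.
  rewrite fE gE -linearD; congr (q _); case: p => x u.
  by congr (_, _); rewrite /= ?addr0 ?add0r.
have [h hE] : exists h : {linear XG -> B}, h =1 fun p => pi p.1 + psi p.2.
  by apply: ex_linear => a x y; rewrite /= !linearP scalerDr addrACA.
have [|pi' pi'E] := @quotient_factor R XG X' B q h qsurj.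
  by move=> p /qP[Np pE]; rewrite hE pE linearN /= phipsi // addNr.
have fgN u x : f x + g u = 0 <-> N u /\ x = - phi u by rewrite -(qfg (x, u)); exact: qP.
have finj : injective f.
  move=> x y /eqP; rewrite -subr_eq0 -linearB => /eqP fxy.
  have [|_ E] := (fgN 0 (x - y)).1; first by rewrite raddf0 addr0.
  by apply/eqP; rewrite -subr_eq0 E phi0 oppr0.
have gN u : N u -> g u = f (phi u).
  move=> Nu; apply/eqP; rewrite -subr_eq0 -linearN addrC; apply/eqP/fgN.
  by split.
have gen z : exists x u, z = f x + g u.
  by have [p <-] := qsurj z; exists p.1, p.2.
have pi'f x : pi' (f x) = pi x by rewrite fE pi'E hE /= raddf0 addr0.
have pi'g u : pi' (g u) = psi u by rewrite gE pi'E hE /= raddf0 add0r.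
exists X', (f \o i), pi', f, g; split=> //; split=> [|a]; last by rewrite /= pi'f pii.
split; first by move=> a a' /finj/iinj.
apply: (@rel_flat_ext R S X' (fun=> True) (fun z => exists x, f x = z)) => //.
- exact: subspace_im.
- exact: (subspace_im (f \o i)).
- by move=> _ [a <-]; exists (i a).
- apply: (@rel_flat_transport R S X X' f (fun=> True) _ _ _ _ _ _ _ _ _).1 fli => //.
  + exact: subspace_im.
  + exact: (subspace_im (f \o i)).
  + by move=> x _; exists x.
  + by move=> x _; split=> [[a <-]|[a /finj]]; exists a.
  + move=> _ [x <-]; exists x => //; rewrite subrr.
    by exists 0; rewrite raddf0.
- apply: (@rel_flat_transport R S G X' g (fun=> True) _ _ _ _ _ _ _ _ _).1 flN => //.
  + exact: subspace_im.
  + move=> u _; split=> [Nu|[x E]]; first by exists (phi u); rewrite gN.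
    have [|Nu _] := (fgN (- u) x).1; first by rewrite linearN /= E subrr.
    by rewrite -[u]opprK; exact: subspaceN.
  + by move=> z _; have [x [u ->]] := gen z; exists u => //; exists x; rewrite addrK.
Qed.

End Pushout.

(* A label records a lifting problem of a submodule N of G against X -> B, where
   X is a quotient of the ambient module built from the labels themselves, so
   that the maximal good pair must solve every problem that it can express. *)
Inductive lift_label (R A B G W : Type) : Type :=
  LiftLabel of (G -> Prop) & (G -> A * seq (R * (lift_label R A B G W * W))) & (W -> B).

HB.instance Definition _ (R A B G W : Type) := gen_eqMixin (lift_label R A B G W).
HB.instance Definition _ (R A B G W : Type) := gen_choiceMixin (lift_label R A B G W).

(** A label names an element of the ambient module built from these labels; adjoining its block will
    kill that element. *)
Inductive kernel_label (R A W : Type) : Type :=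
  KernelLabel of A * seq (R * (kernel_label R A W * W)).

HB.instance Definition _ (R A W : Type) := gen_eqMixin (kernel_label R A W).
HB.instance Definition _ (R A W : Type) := gen_choiceMixin (kernel_label R A W).

Section Codes.
Local Open Scope classical_set_scope.
Variables (R : comNzRingType) (A : lmodType R) (Lam W : choiceType).

(** Labels hold formal combinations, since [amb] can be formed only once the type of labels
    exists. *)
Definition decode (d : A * seq (R * (Lam * W))) : amb A Lam W :=
  (d.1, \sum_(p <- d.2) p.1 *: free_gen R p.2).

Lemma decode_surj (x : amb A Lam W) : exists d, decode d = x.
Proof. by case: x => a u; have [s ->] := free_repr u; exists (a, s). Qed.

Lemma ex_at_label (l : Lam) : exists h : {linear free R W -> amb A Lam W},
  forall t, h (free_gen R t) = gen A l t.
Proof. exact: ex_free_lift. Qed.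

Lemma supported_at_label (L : set Lam) (l : Lam) (h : {linear free R W -> amb A Lam W}) :
  (forall t, h (free_gen R t) = gen A l t) -> L l -> forall u, supported L (h u).
Proof.
move=> hE Ll u; have [s ->] := free_repr u; have sL := @supported_subspace R A Lam W L.
rewrite linear_sum; apply: subspace_sum => // p _.
by rewrite (linearZZ h) hE; apply: subspaceZ => //; exact: supported_gen.
Qed.

End Codes.

(** * A factorization with the right lifting property *)

Section Factorization.
Local Open Scope classical_set_scope.
Variables (R : comNzRingType) (S : mulrClosed R) (A B : lmodType R) (c : {linear A -> B}).

(** For a maximal good pair, a problem with absent label would enlarge the pair by a pushout; once
    the label is present, its block contains a solution. *)
Theorem ex_factorization : exists (X : lmodType R) (i : {linear A -> X}) (pi : {linear X -> B}),
  is_obj S c i pi /\ has_rlp S pi.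
Proof.
pose G := small R.
pose Lam : choiceType := lift_label R A B G (term R).
have [tau [tauA tauE]] := @ex_amb_lift R A Lam (term R) B c
  (fun l t => let: LiftLabel _ _ psi := l in psi t).
(* The block of a label in [L] solves its problem: on [N] it agrees with [phi] modulo [K]. *)
pose Inv (L : set Lam) (K : set (amb A Lam (term R))) := forall N phi psi,
  L (LiftLabel N phi psi) -> forall h : {linear G -> amb A Lam (term R)},
  (forall t, h (free_gen R t) = gen A (LiftLabel N phi psi) t) ->
  forall u, N u -> K (h u - decode (phi u)).
have [||L [K [goodK InvK Kmax]]] := @ex_maximal_good R S A B c Lam (term R) tau tauA Inv.
- by move=> K _ _ N phi psi [].
- move=> I i0 Ls Ks _ InvI _ N phi psi [k _ Ll] h hE u Nu.
  by exists k => //; exact: InvI Ll h hE u Nu.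
have [X [i [pi [q [objX pres]]]]] := good_presents tauA goodK.
have [qA Kq qsurj qpi] := pres.
exists X, i, pi; split=> //; apply: has_small_rlpW => N phi psi sN flN phiL phipsi.
have /choice[phi' phi'P] u : exists d, supported L (decode d) /\ q (decode d) = phi u.
  by have [x Lx qx] := qsurj (phi u); have [d dE] := decode_surj x; exists d; rewrite dE.
pose l := LiftLabel N phi' (fun t => psi (free_gen R t)) : Lam.
have [h hE] := @ex_at_label R A Lam (term R) l.
have tauh u : tau (h u) = psi u.
  by apply: (@free_ext R _ _ (tau \o h) psi) => t; rewrite /= hE tauE.
have Ll : L l.
  have [//|nLl] := pselect (L l).
  have [X' [i' [pi' [f [g [obj' morf gN gpsi gens]]]]]] :=
    ex_pushout objX sN flN phiL phipsi.
  have [|K' [q' [goodK' [_ K'q' _ _] KK' q'f q'l]]] :=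
      ex_extension (w := g) tauA pres obj' nLl morf _ gens.
    by move=> t; rewrite gpsi tauE.
  have LS : L `<=` L `|` [set l] by move=> ? ?; left.
  apply: (Kmax _ _ LS KK' goodK'); last by right.
  move=> N1 phi1 psi1 [Ll1 h1 h1E u Nu|[-> -> ->] h1 h1E u Nu].
    exact/KK'/(InvK _ _ _ Ll1).
  have h1h : h1 =1 h by apply: free_ext => t; rewrite h1E hE.
  apply/K'q'; rewrite h1h; split.
    apply: subspaceB; first exact: supported_subspace.
      by apply: supported_at_label hE _ _; right.
    exact: supportedS (phi'P u).1.
  rewrite linearB (q'f _ (phi'P u).1) (phi'P u).2 -gN //.
  have -> : q' (h u) = g u by apply: (@free_ext R _ _ (q' \o h) g) => t; rewrite /= hE q'l.
  exact: subrr.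
exists (q \o h); split=> u /=.
  move=> Nu; have /Kq[_ /eqP] := InvK _ _ _ Ll h hE u Nu.
  by rewrite linearB subr_eq0 (phi'P u).2 => /eqP.
by rewrite qpi ?tauh //; exact: supported_at_label hE Ll u.
Qed.

End Factorization.

(** * Weakly terminal objects with bijective endomorphisms *)

Section Minimal.
Local Open Scope classical_set_scope.
Variables (R : comNzRingType) (S : mulrClosed R) (A B : lmodType R) (c : {linear A -> B}).

(** If a morphism [f] from [X] to [P] kills an element, adjoining its label replaces [X] by [P]
    along [f] and puts the element into [K]. For a maximal pair all morphisms from [X] to [P] are
    thus injective, and so are the endomorphisms, by composition. *)
Lemma ex_injective_terminal (P : lmodType R) (i0 : {linear A -> P}) (pi0 : {linear P -> B}) :
    weakly_terminal S c i0 pi0 ->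
  exists (X : lmodType R) (i : {linear A -> X}) (pi : {linear X -> B}),
    weakly_terminal S c i pi /\ forall f, is_mor i pi i pi f -> injective f.
Proof.
move=> [objP wtP].
have [sm smE] := @ex_free_lift R P P (fun x => x).
pose Lam : choiceType := kernel_label R A P.
have [tau [tauA tauE]] := @ex_amb_lift R A Lam P B c (fun _ => pi0).
(* Besides killing [decode d], each block satisfies the relations of [P], and so yields a morphism
   from [P] to [X]. *)
pose Inv (L : set Lam) (K : set (amb A Lam P)) := forall d, L (KernelLabel d) ->
  K (decode d) /\ forall h : {linear free R P -> amb A Lam P},
    (forall t, h (free_gen R t) = gen A (KernelLabel d) t) ->
    forall a u, i0 a + sm u = 0 -> K (inA Lam P a + h u).
have [||L [K [goodK InvK Kmax]]] := @ex_maximal_good R S A B c Lam P tau tauA Inv.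
- by move=> K _ _ d [].
- move=> I k0 Ls Ks _ InvI _ d [k _ Ll]; have [Kd Kh] := InvI k d Ll.
  by split=> [|h hE a u E]; exists k => //; exact: Kh E.
have [X [i [pi [q [objX pres]]]]] := good_presents tauA goodK.
have [qA Kq qsurj qpi] := pres.
have LK d (f : {linear X -> P}) : is_mor i pi i0 pi0 f ->
    supported L (decode d) -> f (q (decode d)) = 0 -> L (KernelLabel d).
  move=> morf Ld fd0; pose l := KernelLabel d : Lam.
  have [//|nLl] := pselect (L l).
  have [||K' [q' [goodK' [q'A K'q' _ _] KK' q'f q'l]]] :=
      ex_extension (w := sm) tauA pres objP nLl morf.
  - by move=> t; rewrite smE tauE.
  - by move=> z; exists 0, (free_gen R z); rewrite raddf0 add0r smE.
  have LS : L `<=` L `|` [set l] by move=> ? ?; left.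
  apply: (Kmax _ _ LS KK' goodK'); last by right.
  move=> d1 [Ll1|[->]].
    have [Kd1 Kh1] := InvK _ Ll1.
    by split=> [|h hE a u E]; apply: KK' => //; exact: Kh1 E.
  split=> [|h hE a u E]; apply/K'q'; split.
  - exact: supportedS Ld.
  - by rewrite q'f.
  - apply: subspaceD; [exact: supported_subspace | exact: supported_inA |].
    by apply: supported_at_label hE _ _; right.
  - rewrite linearD q'A -[RHS]E; congr (_ + _).
    apply: (@free_ext R _ _ (q' \o h) sm) => t.
    by rewrite /= hE q'l.
have [f0 morf0] := wtP X i pi objX.
have Kinj (f : {linear X -> P}) : is_mor i pi i0 pi0 f -> injective f.
  move=> morf x y /eqP; rewrite -subr_eq0 -linearB => /eqP.
  have [z Lz qz] := qsurj (x - y); have [d dE] := decode_surj z.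
  rewrite -qz -dE => fd; rewrite -dE in Lz.
  have [/Kq[_ qd] _] := InvK _ (LK d f morf Lz fd).
  by apply/eqP; rewrite -subr_eq0 -qz -dE qd.
(* Zero lies in every kernel, so its label is in [L]: at least one block is available. *)
pose d0 : A * seq (R * (Lam * P)) := (0, [::]).
have d0E : decode d0 = 0 by rewrite /decode big_nil.
have Ll0 : L (KernelLabel d0).
  apply: (LK d0 f0) => //; rewrite d0E ?raddf0 //.
  by have /subspace0 := @supported_subspace R A Lam P L.
have [h hE] := @ex_at_label R A Lam P (KernelLabel d0).
have [_ /(_ h hE) Kh] := InvK _ Ll0.
have Lh u : supported L (h u) by exact: supported_at_label hE Ll0 u.
have qh a u : i0 a + sm u = 0 -> i a + q (h u) = 0.
  by move=> /Kh/Kq[_]; rewrite linearD qA.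
have [k kE] : exists k : {linear P -> X}, k =1 fun p => q (h (free_gen R p)).
  apply: ex_linear => a x y; apply/eqP; rewrite -subr_eq0 -!linearP -!linearB.
  have := qh 0 (free_gen R (a *: x + y) - (a *: free_gen R x + free_gen R y)).
  rewrite !raddf0 !add0r => ->; first by rewrite eqxx.
  by rewrite linearB linearP !smE subrr.
have mork : is_mor i0 pi0 i pi k.
  split=> [a|p]; last by rewrite kE qpi // hE tauE.
  rewrite kE; apply/eqP; rewrite eq_sym -subr_eq0 -!linearN; apply/eqP/qh.
  by rewrite linearN smE subrr.
exists X, i, pi; split=> [|f morf].
  split=> // Y j rho objY; have [g morg] := wtP Y j rho objY.
  by exists (k \o g); exact: is_mor_comp morg mork.
apply: (@inj_compr _ _ _ f0 f); apply: (Kinj (f0 \o f)).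
exact: is_mor_comp morf morf0.
Qed.

Lemma no_injection_from_powerset (T : Type) (f : (T -> Prop) -> T) : ~ injective f.
Proof.
move=> finj; pose D x := exists2 P, f P = x & ~ P x.
have [Dd|nDd] := pselect (D (f D)); last by apply: (nDd); exists D.
by have [P /finj PE] := Dd; rewrite PE.
Qed.

(* If an endomorphism misses p0, then embeddings into F of ever larger S-flat
   extensions can be prolonged through it, which produces more distinct elements
   than F has. *)
Lemma injective_terminal_surj (F : lmodType R) (i : {linear A -> F}) (pi : {linear F -> B}) :
    weakly_terminal S c i pi -> (forall f, is_mor i pi i pi f -> injective f) ->
  forall f, is_mor i pi i pi f -> forall z, exists x, f x = z.
Proof.
move=> [objF wtF] Finj e more p0; have [//|np0] := pselect (exists x, e x = p0).
(* As many labels as subsets of [F]: they cannot inject into [F]. *)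
pose Lam : choiceType := {classic (F -> Prop)}.
have [tau [tauA tauE]] := @ex_amb_lift R A Lam F B c (fun _ => pi).
pose ok (L : set Lam) (K : set (amb A Lam F)) (g : {linear amb A Lam F -> F}) :=
  [/\ forall a, g (inA Lam F a) = i a, forall x, supported L x -> pi (g x) = tau x
    & forall x, K x -> g x = 0].
(* All morphisms from the presented object to [F] are injective, and distinct labels give distinct
   classes of generators at [p0]. *)
pose Inv (L : set Lam) (K : set (amb A Lam F)) :=
  (forall g, ok L K g -> forall x, supported L x -> g x = 0 -> K x) /\
  (forall l l', L l -> L l' -> K (gen A l p0 - gen A l' p0) -> l = l').
have [||L [K [goodK [Kinj Kdist] Kmax]]] := @ex_maximal_good R S A B c Lam F tau tauA Inv.
- move=> K [sK _ _ _ _] _; split=> // g [gA _ _] x /supported_set0 xE gx.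
  have x0 : x.1 = 0 by apply: objF.1.1; rewrite -gA -xE gx raddf0.
  by rewrite xE x0 raddf0; exact: sK.1.
- move=> I k0 Ls Ks _ InvI tot; split=> [g [gA gpi gK] x Lx gx|l l' [k1 _ Ll] [k2 _ Ll'] [k3 _ Kl]].
    have [|k Lkx] := supported_chain k0 _ Lx.
      by move=> k k'; case: (tot k k') => [[]|[]]; [left | right].
    have kS : Ls k `<=` \bigcup_k Ls k by move=> ? ?; exists k.
    exists k => //; apply: (InvI k).1 gx => //; split=> // y Ky.
      by apply: gpi; exact: supportedS Ky.
    by apply: gK; exists k.
  have [k [Lkl Lkl']] : exists k, Ls k l /\ Ls k l'.
    by case: (tot k1 k2) => [[LS _]|[LS _]]; [exists k2 | exists k1]; split=> //; exact: LS.
  case: (tot k k3) => [[LS _]|[_ KS]].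
    by apply: (InvI k3).2 Kl; exact: LS.
  by apply: (InvI k).2 => //; exact: KS.
have [X [j [rho [q [objX pres]]]]] := good_presents tauA goodK.
have [qA Kq qsurj qpi] := pres.
have [u moru] := wtF X j rho objX.
have uK x : supported L x -> u (q x) = 0 -> K x.
  move=> Lx ux; apply: (Kinj (u \o q)) => //; split=> [a|y Ly|y /Kq[_ qy]] /=.
  - by rewrite qA moru.1.
  - by rewrite moru.2 qpi.
  - by rewrite qy raddf0.
have sL := @supported_subspace R A Lam F L.
(* If all labels were used, their generators at [p0] would embed the power set of [F] into [F]. *)
have [l nLl] : exists l, ~ L l.
  apply/not_existsP => Lall.
  have {}Lall l : L l by apply: contrapT; exact: Lall.
  apply: (@no_injection_from_powerset F (fun l => u (q (gen A (l : Lam) p0)))) => l l' E.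
  apply: (Kdist l l') => //; apply: uK; last by rewrite !linearB E subrr.
  by apply: subspaceB => //; exact: supported_gen.
have [sm smE] := @ex_free_lift R F F (fun x => x).
have [||K' [q' [goodK' [q'A K'q' q'surj q'pi] KK' q'f q'l]]] :=
    ex_extension (w := sm) tauA pres objF nLl (is_mor_comp moru more).
- by move=> t; rewrite smE tauE.
- by move=> z; exists 0, (free_gen R z); rewrite raddf0 add0r smE.
have LS : L `<=` L `|` [set l] by move=> ? ?; left.
case: nLl; apply: (Kmax _ _ LS KK' goodK'); last by right.
have sL' := @supported_subspace R A Lam F (L `|` [set l]).
(* Old generators land in the image of [e], the new one at [p0] outside it. *)
have new l1 : L l1 -> ~ K' (gen A l1 p0 - gen A l p0).
  move=> Ll1 /K'q'[_ /eqP]; rewrite linearB subr_eq0 q'l smE q'f.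
    by move=> /eqP E; apply: np0; exists (u (q (gen A l1 p0))).
  exact: supported_gen.
split=> [g [gA gpi gK] x Lx gx|l1 l2 [Ll1|->] [Ll2|->] //].
(* A compatible [g] on the enlarged object is an endomorphism of [F] in disguise, hence
   injective. *)
- have [| | |e' e'P] := @ex_linear_rel R F F (fun z y => exists2 x,
      supported (L `|` [set l]) x /\ q' x = z & g x = y).
  + by move=> z; have [y Ly qy] := q'surj z; exists (g y), y.
  + move=> z y y' [v [Lv vz] <-] [v' [Lv' v'z] <-]; apply/eqP.
    rewrite -subr_eq0 -linearB; apply/eqP/gK/K'q'; split; first exact: subspaceB.
    by rewrite linearB vz v'z subrr.
  + move=> a z y z' y' [v [Lv <-] <-] [v' [Lv' <-] <-]; exists (a *: v + v').
      by split; [exact: sL'.2 | rewrite linearP].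
    by rewrite linearP.
  have e'q v : supported (L `|` [set l]) v -> e' (q' v) = g v.
    move=> Lv; have [v' [Lv' E] <-] := e'P (q' v); apply/eqP.
    rewrite -subr_eq0 -linearB; apply/eqP/gK/K'q'; split; first exact: subspaceB.
    by rewrite linearB E subrr.
  have more' : is_mor i pi i pi e'.
    split=> [a|z]; first by rewrite -q'A e'q ?gA //; exact: supported_inA.
    by have [v Lv <-] := q'surj z; rewrite e'q // gpi // q'pi.
  apply/K'q'; split=> //; apply: (Finj e' more').
  by rewrite e'q // gx raddf0.
- move=> /K'q'[_]; rewrite linearB !q'f; try exact: supported_gen.
  rewrite -linearB /= => exy; apply: Kdist => //; apply: uK.
    by apply: subspaceB => //; exact: supported_gen.
  by apply: (Finj e more); rewrite raddf0 -[RHS]exy !linearB.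
- by move=> /new.
- by move=> E; case: (new l2) => //; rewrite -opprB; apply: subspaceN => //; case: goodK'.
Qed.

Theorem ex_minimal (P : lmodType R) (i0 : {linear A -> P}) (pi0 : {linear P -> B}) :
    weakly_terminal S c i0 pi0 ->
  exists (X : lmodType R) (i : {linear A -> X}) (pi : {linear X -> B}),
    weakly_terminal S c i pi /\ forall f, is_mor i pi i pi f -> bijective f.
Proof.
move=> /ex_injective_terminal[X [i [pi [wtX Xinj]]]].
exists X, i, pi; split=> // f morf.
have /choice[g gK] := injective_terminal_surj wtX Xinj morf.
by exists g => // x; apply: (Xinj f morf).
Qed.

End Minimal.

(** * Covers and envelopes *)

Section MinimalFactorization.
Variables (R : comNzRingType) (S : mulrClosed R) (A B : lmodType R) (c : {linear A -> B}).

Lemma rlp_weakly_terminal (X : lmodType R) (i : {linear A -> X}) (pi : {linear X -> B}) :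
  is_obj S c i pi -> has_rlp S pi -> weakly_terminal S c i pi.
Proof.
move=> objX rlp; split=> // Y j rho [monoj rhoj].
have [|g [gj pig]] := rlp A Y j i rho monoj; last by exists g.
by move=> a; rewrite objX.2 rhoj.
Qed.

(** The minimal object is a retract of [P], as [r \o s] is bijective, and the lifting property
    passes to retracts. *)
Theorem ex_minimal_factorization :
  exists (X : lmodType R) (i : {linear A -> X}) (pi : {linear X -> B}),
    [/\ is_obj S c i pi, has_rlp S pi & forall f, is_mor i pi i pi f -> bijective f].
Proof.
have [P [i0 [pi0 [objP rlpP]]]] := ex_factorization S c.
have wtP := rlp_weakly_terminal objP rlpP.
have [X [i [pi [wtX Xbij]]]] := ex_minimal wtP.
exists X, i, pi; split=> //; first exact: wtX.1.
have [s mors] := wtP.2 _ _ _ wtX.1; have [r morr] := wtX.2 _ _ _ objP.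
have morrs := is_mor_comp mors morr.
have [t tK Kt] := Xbij _ morrs.
have [t' t'E] : exists t' : {linear X -> X}, t' =1 t.
  by apply: ex_linear => a x y; rewrite -{1}[x]Kt -{1}[y]Kt -linearP tK.
move=> A' Y j f h monoj pif.
have [|g [gj pig]] := rlpP A' Y j (s \o f) h monoj.
  by move=> a; rewrite /= mors.2.
exists (t' \o (r \o g)); split=> [a|y] /=; first by rewrite t'E gj; exact: tK.
by rewrite t'E -pig -morr.2 -[in RHS](Kt (r (g y))) morrs.2.
Qed.

End MinimalFactorization.

(** * From factorizations to covers, envelopes and orthogonality *)

Section SFlatSCotorsion.
Variables (R : comNzRingType) (S : mulrClosed R).
Implicit Types M N X Q B F C : lmodType R.

Let O : lmodType R := 'rV[R]_0.

Let O_eq0 (x : O) : x = 0. Proof. exact: thinmx0. Qed.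

Lemma SF_mono_O X (i : {linear O -> X}) : SF_mono S i <-> S_flat S X.
Proof.
have iE : (fun x => exists a, i a = x) = (fun x => x = 0).
  apply/funext => x; apply/propext; split=> [[a <-]|->]; last by exists 0; rewrite raddf0.
  by rewrite (O_eq0 a) raddf0.
rewrite S_flatP /SF_mono iE; split=> [[]//|]; split=> // x y _.
by rewrite (O_eq0 x) (O_eq0 y).
Qed.

Lemma S_flat_quotient X Q (D : X -> Prop) (q : {linear X -> Q}) :
    (forall x, q x = 0 <-> D x) -> (forall z, exists x, q x = z) ->
  rel_flat S (fun=> True) D <-> S_flat S Q.
Proof.
move=> qD qsurj; rewrite S_flatP.
apply: (@rel_flat_transport R S X Q q) => //; first exact: subspace_zero.
  by move=> x _; rewrite qD.
by move=> z _; have [x <-] := qsurj z; exists x; rewrite ?subrr.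
Qed.

Lemma S_flat_retract X M (p : {linear X -> M}) (s : {linear M -> X}) :
  (forall z, p (s z) = z) -> S_flat S X -> S_flat S M.
Proof.
move=> ps /S_flatP fl; apply/S_flatP => n a m _ am0.
have [||t [k [b [y [tS _ ab yE]]]]] := fl n a (s \o m) => //.
  transitivity (s (\sum_i a i *: m i)); last by rewrite am0 raddf0.
  by rewrite linear_sum; apply: eq_bigr => i _; rewrite (linearZZ s).
exists t, k, b, (p \o y); split=> // i.
have := congr1 p (yE i); rewrite raddf0 => E; rewrite -[RHS]E.
rewrite (linearB p) (linearZZ p) ps (linear_sum p).
by congr (_ - _); apply: eq_bigr => j _; rewrite (linearZZ p).
Qed.

(** A relation in the ring is solved by the single element 1 with coefficients [m i]. *)
Lemma S_flat_regular : S_flat S R^o.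
Proof.
apply/S_flatP => n a m _ am0; exists 1, 1%N, (fun i _ => m i), (fun=> 1).
split=> // [|i]; first exact: rpred1.
by rewrite big_ord1 scale1r [m i *: _]mulr1 subrr.
Qed.

(** For S-flat [F] the inclusion of [ker (aug F)] into [res0 F] has S-flat cokernel, so maps to [C]
    extend along it. *)
Lemma rlp_S_cotorsion C (pi : {linear C -> O}) : has_rlp S pi -> S_cotorsion S C.
Proof.
move=> rlp F flF; apply: Ext1_trivial_of_extend => phi.
have [||Phi [PhiE _]] := rlp _ _ (ker_incl (aug F)) phi \0.
- split; first exact: val_inj.
  apply/(S_flat_quotient (q := aug F)) => // [x|z]; first exact: kerP.
  by exists (free_gen R z); rewrite augE.
- by move=> a; rewrite (O_eq0 (pi _)).
by exists Phi.
Qed.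

Lemma rlp_ker X B (pi : {linear X -> B}) : has_rlp S pi ->
  has_rlp S (\0 : {linear ker pi -> O}).
Proof.
move=> rlp A Y j f h monoj _.
have [|g [gj pig]] := rlp A Y j (ker_incl pi \o f) \0 monoj.
  by move=> a; apply/kerP; exists (f a).
have [| | |g' g'E] := @ex_linear_rel R Y (ker pi) (fun y z => ker_incl pi z = g y).
- by move=> y; apply/kerP; rewrite pig.
- by move=> y z z' <- /val_inj.
- by move=> a y z y' z' E E'; rewrite !linearP E E'.
exists g'; split=> [a|y]; last by rewrite (O_eq0 (h y)).
by apply: val_inj; rewrite -[LHS]/(ker_incl pi _) g'E gj.
Qed.

(** [R^o] is S-flat, so the map sending 1 to [z] lifts along [pi]. *)
Lemma rlp_surj X B (pi : {linear X -> B}) : has_rlp S pi -> forall z, exists x, pi x = z.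
Proof.
move=> rlp z.
have [h hE] : exists h : {linear R^o -> B}, h =1 fun r => r *: z.
  by apply: ex_linear => a x y; rewrite scalerDl -scalerA.
have [||g [_ gE]] := rlp O R^o \0 \0 h.
- exact/SF_mono_O/S_flat_regular.
- by move=> a; rewrite !raddf0.
by exists (g 1); rewrite gE hE scale1r.
Qed.

(** The case of [rel_flat_sub] with U = M, U' the image of [i] and D = 0. *)
Lemma S_flat_hereditary : hereditary (@S_flat R S).
Proof.
move=> M' M M'' i p [iinj ip psurj] flM flM''.
apply/S_flatP.
apply: (@rel_flat_transport R S M' M i (fun=> True) (fun x => x = 0)
  (fun y => exists x, i x = y) (fun x => x = 0) _ _ _ _ _ _).2 => //.
- exact: subspace_im.
- exact: subspace_zero.
- by move=> x _; exists x.
- by move=> x _; split=> [->|/eqP]; rewrite ?raddf0 // -(raddf0 i) => /eqP/iinj.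
- by move=> _ [x <-]; exists x; rewrite ?subrr.
apply: (@rel_flat_sub R S M (fun=> True)) => //.
- exact: subspace_im.
- exact: subspace_zero.
- by move=> x ->; exists 0; rewrite raddf0.
- exact/S_flatP.
- exact/(S_flat_quotient ip psurj).
Qed.

(** With A = 0, weak terminality is the precover property. *)
Lemma ex_S_flat_cover M : exists N (phi : {linear N -> M}), is_cover (@S_flat R S) phi.
Proof.
have [X [i [pi [objX rlp Xbij]]]] := ex_minimal_factorization S (\0 : {linear O -> M}).
exists X, pi; split; first split.
- exact/(SF_mono_O i)/objX.1.
- move=> N flN f; have [_ wt] := rlp_weakly_terminal objX rlp.
  have [|g [_ gE]] := wt N \0 f; last by exists g.
  by split; [exact/SF_mono_O | move=> a; rewrite raddf0].
- move=> g gE; apply: Xbij; split=> [a|x]; last exact: gE.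
  by rewrite (O_eq0 a) !raddf0.
Qed.

(** With B = 0, the lifting property makes [X] S-cotorsion, and maps to S-cotorsion modules extend
    along [i] because its cokernel is S-flat. *)
Lemma ex_S_cotorsion_envelope M :
  exists N (phi : {linear M -> N}), is_envelope (@S_cotorsion R S) phi.
Proof.
have [X [i [pi [objX rlp Xbij]]]] := ex_minimal_factorization S (\0 : {linear M -> O}).
exists X, i; split; first split.
- exact: rlp_S_cotorsion rlp.
- move=> C cotC f; have [Q [q [qE qsurj]]] := ex_quotient (subspace_im i).
  have [||g gE] := @Ext1_trivial_extend R Q C M X i q f; last by exists g.
    by split=> //; exact: objX.1.1.
  by apply: cotC; apply/(S_flat_quotient qE qsurj)/objX.1.2.
- move=> g gE; apply: Xbij; split=> [a|x]; first exact: gE.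
  by rewrite (O_eq0 (pi _)) [RHS]O_eq0.
Qed.

(** The kernel of [pi] is S-cotorsion, so its identity extends to a retraction [r] of the S-flat
    module [X], and [M] is a direct summand of [X]. *)
Lemma lperp_S_cotorsion M : lperp (@S_cotorsion R S) M -> S_flat S M.
Proof.
have [X [i [pi [objX rlp _]]]] := ex_minimal_factorization S (\0 : {linear O -> M}).
move=> extM; have pisurj := rlp_surj rlp.
have ex_ker : short_exact (ker_incl pi) pi.
  by split=> [|x|//]; [exact: val_inj | exact: kerP].
have [|r rE] := Ext1_trivial_extend idfun ex_ker.
  exact/extM/(rlp_S_cotorsion (rlp_ker rlp)).
(* The section picks in each fibre of [pi] the point killed by [r]. *)
have [| | |s sE] := @ex_linear_rel R M X (fun z x => pi x = z /\ r x = 0).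
- move=> z; have [x <-] := pisurj z; exists (x - ker_incl pi (r x)).
  have pik : pi (ker_incl pi (r x)) = 0 by apply/kerP; exists (r x).
  by rewrite (linearB pi) (linearB r) rE subrr pik subr0.
- move=> z x x' [xz rx] [x'z rx']; apply/eqP; rewrite -subr_eq0; apply/eqP.
  have /kerP[w wE] : pi (x - x') = 0 by rewrite linearB xz x'z subrr.
  by rewrite -wE -[w]rE wE linearB rx rx' subrr raddf0.
- move=> a z x z' x' [<- rx] [<- rx']; split; rewrite linearP //.
  by rewrite rx rx' scaler0 addr0.
apply: (@S_flat_retract X M pi s); first by move=> z; have [] := sE z.
exact/(SF_mono_O i)/objX.1.
Qed.

End SFlatSCotorsion.

Theorem theorem3p8 (R : comNzRingType) (S : mulrClosed R) (S0 : 0 \notin S) :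
  [/\ cotorsion_pair (@S_flat R S) (@S_cotorsion R S),
      perfect (@S_flat R S) (@S_cotorsion R S)
    & hereditary (@S_flat R S)].
Proof.
split; last exact: S_flat_hereditary.
  (* The right orthogonal of the S-flat modules is the S-cotorsion class by definition; only the
     left orthogonal calls for an argument. *)
  split=> [//|M]; split; first exact: lperp_S_cotorsion.
  by move=> flM C; apply.
by split; [exact: ex_S_flat_cover | exact: ex_S_cotorsion_envelope].
Qed.
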